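(* For every integer $r\geq 2$, the sequence $(H_r(n,n))_{n\geq 1}$ is D-finite. In particular, the sequences $(H_2(n,n))_{n\geq1}$ (OEIS A253217) and $(H_3(n,n))_{n\geq1}$ (OEIS A252998) are D-finite.
   Context: For positive integers $r,n,k$, let $H_r(n,k)$ be the number of $n\times k$ arrays of integers (rows indexed $i=1,\dots,n$, columns indexed $j=1,\dots,k$) which obey the following rules: (1) the entry in position $(1,1)$ is $0$, and the entry in position $(n,k)$ is $\max(n,k)-r-1$; (2) the entry in position $(i,j)$ must equal or be one more than each of the entries in positions $(i-1,j)$, $(i,j-1)$, and $(i-1,j-1)$ (whenever those positions exist in the array); (3) the entry in position $(i,j)$ must be within $r$ of $\max(i,j)-1$, i.e. differ from it by at most $r$ in absolute value. (If the rules are contradictory, the count is $0$.) A sequence $(f(n))_{n\ge1}$ of rational numbers is called D-finite if it satisfies a linear recurrence with polynomial coefficients, i.e. there exist an integer $d\geq0$ and polynomials $p_0,\dots,p_d\in\mathbb{Q}[x]$, not all zero, such that $p_0(n)f(n)+p_1(n)f(n+1)+\cdots+p_d(n)f(n+d)=0$ for all $n\geq1$. *)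

(* Defs.v *)
From HB Require Import structures.
From mathcomp Require Import all_boot all_order all_algebra finmap. From mathcomp Require Import zify.
From mathcomp Require Import boolp classical_sets functions cardinality.
Set Implicit Arguments.
Unset Strict Implicit.
Unset Printing Implicit Defensive.
Import Order.TTheory GRing.Theory Num.Theory.
Local Open Scope classical_set_scope.
Local Open Scope ring_scope.

(* Ordinals are 0-based: entry [A i j] is the one in position (i+1, j+1). *)

Definition corner_rule (r n k : nat) (A : 'M[int]_(n, k)) : Prop :=
  (forall (i : 'I_n) (j : 'I_k), i.+1 = 1%N -> j.+1 = 1%N -> A i j = 0) /\
  (forall (i : 'I_n) (j : 'I_k), i.+1 = n -> j.+1 = k ->
     A i j = (maxn n k)%:Z - r%:Z - 1).

(* [precedes i' j' i j]: (i', j') is (i-1, j), (i, j-1) or (i-1, j-1). *)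
Definition precedes (i' j' i j : nat) : Prop :=
  [\/ i'.+1 = i /\ j' = j, i' = i /\ j'.+1 = j | i'.+1 = i /\ j'.+1 = j].

Definition step_rule (n k : nat) (A : 'M[int]_(n, k)) : Prop :=
  forall (i i' : 'I_n) (j j' : 'I_k), precedes i' j' i j ->
    A i j = A i' j' \/ A i j = A i' j' + 1.

Definition band_rule (r n k : nat) (A : 'M[int]_(n, k)) : Prop :=
  forall (i : 'I_n) (j : 'I_k),
    `|A i j - ((maxn i.+1 j.+1)%:Z - 1)| <= r%:Z.

Definition valid_arrays (r n k : nat) : set 'M[int]_(n, k) :=
  [set A | [/\ corner_rule r A, step_rule A & band_rule r A]].
Arguments valid_arrays : clear implicits.

(* [fset_set] is empty on infinite sets, so [H] relies on this finiteness. *)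
Lemma finite_valid_arrays (r n k : nat) : finite_set (valid_arrays r n k).
Proof.
pose B := ((n + k) + r)%N.
pose dec (M : 'M['I_(B + r).+1]_(n, k)) : 'M[int]_(n, k) :=
  \matrix_(i, j) ((M i j)%:Z - r%:Z).
apply: (@sub_finite_set _ _ (dec @` setT)); last first.
  exact/finite_image/finite_finset.
move=> A [_ _ Ab].
exists (\matrix_(i, j) inord (absz (A i j + r%:Z))) => //.
apply/matrixP => i j; rewrite !mxE.
have := Ab i j; rewrite ler_norml => /andP[lo hi].
have mx : (maxn i.+1 j.+1 <= n + k)%N.
  by rewrite geq_max (leq_trans (ltn_ord i) (leq_addr _ _))
             (leq_trans (ltn_ord j) (leq_addl _ _)).
have m0 : (0 < maxn i.+1 j.+1)%N by rewrite leq_max.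
have ge0 : 0 <= A i j + r%:Z by lia.
rewrite inordK; last by rewrite /B; lia.
by rewrite gez0_abs // addrK.
Qed.

Definition H (r n k : nat) : nat := #|` fset_set (valid_arrays r n k)|%fset.

(* The sequence is indexed from 1; the value [f 0] plays no role. *)
Definition D_finite (f : nat -> rat) : Prop :=
  exists (d : nat) (p : 'I_d.+1 -> {poly rat}),
    (exists i, p i != 0) /\
    forall n : nat, (1 <= n)%N -> \sum_(i < d.+1) (p i).[n%:R] * f (n + i)%N = 0.

(* Main.v *)
(* The deficit max(i,j) - 1 - entry lies between 0 and r. In the upper triangle its
   level lines form r non-intersecting walkers, each step moving every walker by 0 or 1
   until it is absorbed on the diagonal; the lower triangle is a second such
   family with the same absorption times. Reading the walkers from the corner
   (n,n) backwards, the number of pairs of families ending in given positions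
   obeys the same recurrence as a determinant with entries
   sum_(p < t) 'C(p, x) * 'C(p, y), so H_r(n,n) is a sum of such r x r
   determinants over all pairs of strictly decreasing sequences below n.

   For fixed r this is a multiple sum of a holonomic function. A function f of d
   natural variables k_i is called holonomic when the span of all words of length
   <= K in the operators k_i (multiplication) and E_i (backward shift), applied to
   f, has dimension O(K^d). Bernstein-style dimension counts show that
   this class is closed under products in separate variables, under inverting
   operators 1 - E_t(...), hence under partial summation, and under identifying
   two variables. For d = 1 there are about K^2 words k^a E^b but only O(K)
   dimensions, so a linear relation, i.e. a polynomial recurrence, exists. *)
Require Import Defs.
From HB Require Import structures.
From mathcomp Require Import all_boot all_order all_algebra.
From mathcomp Require Import zify ring.
From mathcomp Require Import perm finmap boolp classical_sets functions cardinality.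
Import Order.TTheory GRing.Theory Num.Theory.
Set Implicit Arguments.
Unset Strict Implicit.
Unset Printing Implicit Defensive.
Local Open Scope ring_scope.

(** * Holonomic functions of finitely many natural variables *)
Definition env := nat -> nat.
(* [rat^o] is [rat] as a module over itself, which makes [fn] an lmodType. *)
Definition fn := env -> rat^o.
HB.instance Definition _ := GRing.Lmodule.on fn.

Definition upd (k : env) (i v : nat) : env := fun j => if j == i then v else k j.

(** Backward shift, with functions extended by zero to negative arguments. Hence shifts in all
    variables commute, and a word containing the shift in [t] vanishes at [k t = 0]. *)
Definition shift (i : nat) (h : fn) : fn :=
  fun k => if k i is v.+1 then h (upd k i v) else 0.

Definition mulv (i : nat) (h : fn) : fn := fun k => (k i)%:R * h k.

Definition restr (i j : nat) (h : fn) : fn := fun k => h (upd k i (k j)).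

Lemma fnD (f g : fn) k : (f + g) k = f k + g k. Proof. by []. Qed.
Lemma fnN (f : fn) k : (- f) k = - f k. Proof. by []. Qed.
Lemma fnZ (a : rat) (f : fn) k : (a *: f) k = a * f k. Proof. by []. Qed.
Lemma fn0 k : (0 : fn) k = 0. Proof. by []. Qed.
Lemma fn_sum I (r : seq I) (P : pred I) (F : I -> fn) k :
  (\sum_(i <- r | P i) F i) k = \sum_(i <- r | P i) F i k.
Proof. by elim/big_rec2: _ => // i x y _ <-. Qed.

Lemma shift_linear i : linear (shift i).
Proof.
move=> a g h; apply: funext => k.
rewrite fnD fnZ /shift; case: (k i) => [|v] //.
by rewrite mulr0 addr0.
Qed.
HB.instance Definition _ i :=
  GRing.isLinear.Build rat fn fn _ (shift i) (shift_linear i).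

Lemma mulv_linear i : linear (mulv i).
Proof.
by move=> a g h; apply: funext => k; rewrite /mulv !(fnD, fnZ) mulrDr mulrCA.
Qed.
HB.instance Definition _ i :=
  GRing.isLinear.Build rat fn fn _ (mulv i) (mulv_linear i).

Lemma restr_linear i j : linear (restr i j).
Proof. by []. Qed.
HB.instance Definition _ i j :=
  GRing.isLinear.Build rat fn fn _ (restr i j) (restr_linear i j).

(** The Bernstein filtration of the module generated by [f] over the algebra of multiplications and
    backward shifts in the variables of [A]. *)
Inductive filt (A : seq nat) (f : fn) : nat -> fn -> Prop :=
| filt_base : filt A f 0 f
| filt_lin K a g h : filt A f K g -> filt A f K h -> filt A f K (a *: g + h)
| filt_up K g : filt A f K g -> filt A f K.+1 g
| filt_mulv K i g : i \in A -> filt A f K g -> filt A f K.+1 (mulv i g)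
| filt_shift K i g : i \in A -> filt A f K g -> filt A f K.+1 (shift i g).

Section Filt.
Variables (A : seq nat) (f : fn).

Lemma filt0 K : filt A f K 0.
Proof.
have h0 : filt A f 0 0.
  rewrite -[0](addNr f) -scaleN1r; exact: filt_lin (filt_base _ _) (filt_base _ _).
by elim: K => // K IH; apply: filt_up.
Qed.

Lemma filtZ K a g : filt A f K g -> filt A f K (a *: g).
Proof. by move=> h; rewrite -[_ *: _]addr0; apply: filt_lin => //; apply: filt0. Qed.

Lemma filtD K g h : filt A f K g -> filt A f K h -> filt A f K (g + h).
Proof. by move=> hg hh; rewrite -[g]scale1r; apply: filt_lin. Qed.

Lemma filtB K g h : filt A f K g -> filt A f K h -> filt A f K (g - h).
Proof. by move=> hg hh; rewrite -scaleN1r; apply: filtD => //; apply: filtZ. Qed.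

Lemma filt_mono K L g : (K <= L)%N -> filt A f K g -> filt A f L g.
Proof.
move=> /subnK <-; elim: (L - K)%N => // m IH hg.
by rewrite addSn; apply: filt_up; apply: IH.
Qed.
End Filt.

Lemma filt_trans A f g K L h : filt A f K g -> filt A g L h -> filt A f (K + L) h.
Proof.
move=> hg; elim=> {L h} [|L a h1 h2 _ h1F _ h2F|L h _ hF|L i h iA _ hF|L i h iA _ hF].
- by rewrite addn0.
- exact: filt_lin.
- by rewrite addnS; apply: filt_up.
- by rewrite addnS; apply: filt_mulv.
- by rewrite addnS; apply: filt_shift.
Qed.

(** * Dimension bounds and holonomic functions *)

Definition indep (I : finType) (h : I -> fn) : Prop :=
  forall c : I -> rat, \sum_i c i *: h i = 0 -> forall i, c i = 0.

(** A dimension bound for the span of [P]. The spanning family need not lie in [P], so the bound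
    passes to subsets. *)
Definition spanned (n : nat) (P : fn -> Prop) : Prop :=
  exists (I : finType) (b : I -> fn), (#|I| <= n)%N /\
    forall g, P g -> exists c : I -> rat, g = \sum_i c i *: b i.

(** The coefficient matrix of [h] over a spanning family has independent rows, so it has at least as
    many columns as rows. *)
Lemma indep_leq (I : finType) (h : I -> fn) n (P : fn -> Prop) :
  spanned n P -> (forall i, P (h i)) -> indep h -> (#|I| <= n)%N.
Proof.
move=> [J [b [leJn hb]]] hP hI; apply: leq_trans leJn.
have /boolp.choice[M hM] : forall i, exists c : J -> rat, h i = \sum_j c j *: b j.
  by move=> i; apply: hb.
pose Mx := \matrix_(i < #|I|, j < #|J|) M (enum_val i) (enum_val j).
suff fr : row_free Mx by move/eqP: fr => <-; apply: rank_leq_col.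
apply: inj_row_free => v vM0.
have c0 : \sum_i v 0 (enum_rank i) *: h i = 0.
  under eq_bigr => i _ do rewrite hM scaler_sumr.
  rewrite exchange_big big1 // => j _.
  under eq_bigr => i _ do rewrite scalerA.
  rewrite -scaler_suml.
  have := congr1 (fun u : 'rV_#|J| => u 0 (enum_rank j)) vM0.
  rewrite !mxE (reindex (@enum_rank I)); last first.
    by exists enum_val => x _; rewrite ?enum_rankK ?enum_valK.
  under eq_bigr => i _ do rewrite mxE !enum_rankK.
  by move=> ->; rewrite scale0r.
by apply/rowP => i; rewrite mxE -(enum_valK i); apply: (hI (fun i => v 0 (enum_rank i))).
Qed.

Lemma not_indep (I : finType) (h : I -> fn) :
  ~ indep h -> exists c : I -> rat, \sum_i c i *: h i = 0 /\ exists i, c i != 0.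
Proof.
move=> /existsNP[c] /not_implyP[c0] /existsNP[i] /eqP ci.
by exists c; split => //; exists i.
Qed.

(** An independent family in [P] of maximal size spans [P]: adding any [g] creates a relation, in
    which [g] has a nonzero coefficient because the family itself is independent. *)
Lemma spanned_of_indep n (P : fn -> Prop) :
  (forall (I : finType) (h : I -> fn),
     (forall i, P (h i)) -> indep h -> (#|I| <= n)%N) ->
  spanned n P.
Proof.
move=> hP.
pose Q m := `[< exists h : 'I_m -> fn, (forall i, P (h i)) /\ indep h >].
have Q0 : exists m, Q m.
  exists 0%N; apply/asboolP; exists (fun _ => 0); split; first by case.
  by move=> c _; case.
have Qn m : Q m -> (m <= n)%N.
  by move=> /asboolP[h [hh hi]]; rewrite -[m]card_ord; apply: hP hi.
have [m /asboolP[h [hh hi]] mmax] := ex_maxnP Q0 Qn.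
exists 'I_m, h; split; first by rewrite card_ord; apply: Qn; apply/asboolP; exists h.
move=> g Pg.
pose h' (i : 'I_m.+1) := oapp h g (unlift ord0 i).
have Ph' i : P (h' i) by rewrite /h'; case: unlift.
have [c [c0 [i0 ci0]]] : exists c : 'I_m.+1 -> rat,
    \sum_i c i *: h' i = 0 /\ exists i, c i != 0.
  apply: not_indep => h'i; suff : (m.+1 <= m)%N by rewrite ltnn.
  by apply: mmax; apply/asboolP; exists h'.
move: c0; rewrite big_ord_recl /h' unlift_none /=.
under eq_bigr => i _ do rewrite liftK /=.
move=> c0; have [cz|cnz] := eqVneq (c ord0) 0.
  move: c0; rewrite cz scale0r add0r => /(hi (fun i => c (lift ord0 i))) c0.
  by move: ci0; case: (unliftP ord0 i0) => [j ->|->]; rewrite ?c0 ?cz eqxx.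
exists (fun i => - (c ord0)^-1 * c (lift ord0 i)).
under eq_bigr => i _ do rewrite -scalerA.
rewrite -scaler_sumr -(addr0_eq c0) scalerN scalerA mulrC mulrN mulfV // scaleN1r.
by rewrite opprK.
Qed.

Definition dep (A : seq nat) (f : fn) : Prop :=
  forall k k' : env, {in A, k =1 k'} -> f k = f k'.

(** Minimal growth in the Bernstein filtration, the exponent being the number of variables. The base
    [K.+1] keeps the bound usable at [K = 0], where the filtration already contains [f]. *)
Definition hol (A : seq nat) (f : fn) : Prop :=
  dep A f /\ exists C, forall K, spanned (C * K.+1 ^ size A) (filt A f K).

Lemma filt_sub A B f K g : {subset A <= B} -> filt A f K g -> filt B f K g.
Proof.
move=> AB; elim=> {K g} [|K a g h _ hg _ hh|K g _ hg|K i g iA _ hg|K i g iA _ hg].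
- exact: filt_base.
- exact: filt_lin.
- exact: filt_up.
- by apply: filt_mulv => //; apply: AB.
- by apply: filt_shift => //; apply: AB.
Qed.

Lemma spanned_sub n (P Q : fn -> Prop) :
  (forall g, P g -> Q g) -> spanned n Q -> spanned n P.
Proof.
by move=> PQ [I [b [In hb]]]; exists I, b; split => // g /PQ; apply: hb.
Qed.

Lemma spanned_leq m n P : (m <= n)%N -> spanned m P -> spanned n P.
Proof. by move=> mn [I [b [Im hb]]]; exists I, b; rewrite (leq_trans Im). Qed.

Lemma hol_perm A B f : perm_eq A B -> hol A f -> hol B f.
Proof.
move=> AB [df [C hC]]; split.
  by move=> k k' kk'; apply: df => i; rewrite (perm_mem AB); apply: kk'.
exists C => K; rewrite -(perm_size AB).
apply: spanned_sub (hC K) => g; apply: filt_sub => i; by rewrite (perm_mem AB).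
Qed.

Lemma updE k i v j : upd k i v j = if j == i then v else k j. Proof. by []. Qed.

Lemma updC k i j v w : i != j -> upd (upd k i v) j w = upd (upd k j w) i v.
Proof.
move=> ij; apply: funext => l; rewrite !updE.
by case: (eqVneq l j) => // ->; rewrite eq_sym (negPf ij).
Qed.

Lemma upd_upd k i v w : upd (upd k i v) i w = upd k i w.
Proof. by apply: funext => l; rewrite !updE; case: eqP. Qed.

Lemma dep_shift A f i : i \in A -> dep A f -> dep A (shift i f).
Proof.
move=> iA df k k' kk'; rewrite /shift -(kk' i iA); case: (k i) => // v.
by apply: df => j jA; rewrite !updE; case: eqP => // _; apply: kk'.
Qed.

Lemma dep_mulv A f i : i \in A -> dep A f -> dep A (mulv i f).
Proof. by move=> iA df k k' kk'; rewrite /mulv kk' // (df _ _ kk'). Qed.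

Lemma filt_dep A f K g : dep A f -> filt A f K g -> dep A g.
Proof.
move=> df; elim=> {K g} [|K a g h _ hg _ hh|K g _ hg|K i g iA _ hg|K i g iA _ hg] //.
- by move=> k k' kk'; rewrite !fnD !fnZ (hg _ _ kk') (hh _ _ kk').
- exact: dep_mulv.
- exact: dep_shift.
Qed.

Lemma dep_upd A f i k v : i \notin A -> dep A f -> f (upd k i v) = f k.
Proof.
by move=> iA df; apply: df => j jA; rewrite updE; case: eqP jA iA => // -> ->.
Qed.

(** * Products in separate variables, sums, and point masses *)

Definition fmul (f g : fn) : fn := fun k => f k * g k.

Lemma shift_fmull A i f g : i \notin A -> dep A g ->
  shift i (fmul f g) = fmul (shift i f) g.
Proof.
move=> iA dg; apply: funext => k; rewrite /shift /fmul; case: (k i) => [|v].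
  by rewrite mul0r.
by rewrite (dep_upd _ _ iA dg).
Qed.

Lemma fmulC f g : fmul f g = fmul g f.
Proof. by apply: funext => k; rewrite /fmul mulrC. Qed.

Lemma shift_fmulr A i f g : i \notin A -> dep A f ->
  shift i (fmul f g) = fmul f (shift i g).
Proof. by move=> iA df; rewrite fmulC (shift_fmull _ iA df) fmulC. Qed.

Inductive tens (P Q : fn -> Prop) : fn -> Prop :=
| tens_mul g h : P g -> Q h -> tens P Q (fmul g h)
| tens_lin a g h : tens P Q g -> tens P Q h -> tens P Q (a *: g + h).

Lemma tens_sub (P P' Q Q' : fn -> Prop) h :
  (forall g, P g -> P' g) -> (forall g, Q g -> Q' g) -> tens P Q h -> tens P' Q' h.
Proof.
move=> PP QQ; elim=> {h} [g h Pg Qh|a g h _ hg _ hh].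
  by apply: tens_mul; [apply: PP | apply: QQ].
exact: tens_lin.
Qed.

Lemma spanned_tens m n P Q : spanned m P -> spanned n Q -> spanned (m * n) (tens P Q).
Proof.
move=> [I [b [Im hb]]] [J [c [Jn hc]]].
exists (I * J)%type, (fun p => fmul (b p.1) (c p.2)); split.
  by rewrite card_prod leq_mul.
move=> h; elim=> {h} [g h /hb[u ->] /hc[v ->]|a g h _ [u ->] _ [v ->]].
  exists (fun p => u p.1 * v p.2); apply: funext => k.
  rewrite /fmul !fn_sum big_distrlr /= pair_bigA /=.
  by apply: eq_bigr => -[i j] _ /=; rewrite !fnZ mulrACA.
exists (fun p => a * u p + v p); rewrite scaler_sumr -big_split /=.
by apply: eq_bigr => p _; rewrite scalerDl scalerA.
Qed.

(** Each operator acts on one factor only, since the other factor does not depend on its variable. A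
    word of length [K] thus splits into words of length at most [K] on each factor. *)
Lemma filt_tens A B f g K h : dep A f -> dep B g ->
  {in A, forall i, i \notin B} ->
  filt (A ++ B) (fmul f g) K h -> tens (filt A f K) (filt B g K) h.
Proof.
move=> df dg AB.
have BA : {in B, forall i, i \notin A} by move=> i iB; apply/negP => /AB; rewrite iB.
have up L h' : tens (filt A f L) (filt B g L) h' ->
    tens (filt A f L.+1) (filt B g L.+1) h'.
  by apply: tens_sub => ?; apply: filt_up.
elim=> {K h} [|K a h1 h2 _ T1 _ T2|K h _ T|K i h iAB _ T|K i h iAB _ T].
- by apply: tens_mul; apply: filt_base.
- exact: tens_lin.
- exact: up.
- elim: T => {h} [u v fu gv|a u v _ hu _ hv]; last first.
    by rewrite linearP; apply: tens_lin.
  move: iAB; rewrite mem_cat => /orP[iA|iB].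
    have -> : mulv i (fmul u v) = fmul (mulv i u) v.
      by apply: funext => k; rewrite /mulv /fmul mulrA.
    by apply: tens_mul; [apply: filt_mulv | apply: filt_up].
  have -> : mulv i (fmul u v) = fmul u (mulv i v).
    by apply: funext => k; rewrite /mulv /fmul mulrCA.
  by apply: tens_mul; [apply: filt_up | apply: filt_mulv].
- elim: T => {h} [u v fu gv|a u v _ hu _ hv]; last first.
    by rewrite linearP; apply: tens_lin.
  move: iAB; rewrite mem_cat => /orP[iA|iB].
    rewrite (shift_fmull _ (AB i iA) (filt_dep dg gv)).
    by apply: tens_mul; [apply: filt_shift | apply: filt_up].
  rewrite (shift_fmulr _ (BA i iB) (filt_dep df fu)).
  by apply: tens_mul; [apply: filt_up | apply: filt_shift].
Qed.

Lemma hol_tensor A B f g : {in A, forall i, i \notin B} ->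
  hol A f -> hol B g -> hol (A ++ B) (fmul f g).
Proof.
move=> AB [df [C hC]] [dg [D hD]]; split.
  move=> k k' kk'; rewrite /fmul (df k k') ?(dg k k') // => i iA; apply: kk';
    by rewrite mem_cat iA ?orbT.
exists (C * D)%N => K; rewrite size_cat expnD mulnACA.
apply: spanned_sub (spanned_tens (hC K) (hD K)) => h.
exact: filt_tens.
Qed.

Lemma hol_add A f g : hol A f -> hol A g -> hol A (f + g).
Proof.
move=> [df [C hC]] [dg [D hD]]; split.
  by move=> k k' kk'; rewrite !fnD (df _ _ kk') (dg _ _ kk').
exists (C + D)%N => K; rewrite mulnDl.
have [I [b [Im hb]]] := hC K; have [J [c [Jn hc]]] := hD K.
exists (I + J)%type, (fun p => match p with inl i => b i | inr j => c j end).
split; first by rewrite card_sum leq_add.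
suff S L h : filt A (f + g) L h -> exists u v, [/\ filt A f L u, filt A g L v & h = u + v].
  move=> h /S [u [v [/hb[x ->] /hc[y ->] ->]]].
  exists (fun p => match p with inl i => x i | inr j => y j end).
  by rewrite big_sumType.
elim=> {L h} [|L a h1 h2 _ [u [v [hu hv ->]]] _ [u' [v' [hu' hv' ->]]]
  |L h _ [u [v [hu hv ->]]]|L i h iA _ [u [v [hu hv ->]]]|L i h iA _ [u [v [hu hv ->]]]].
- by exists f, g; split => //; apply: filt_base.
- exists (a *: u + u'), (a *: v + v'); split; try exact: filt_lin.
  by rewrite scalerDr addrACA.
- by exists u, v; split => //; apply: filt_up.
- by exists (mulv i u), (mulv i v); split; [exact: filt_mulv.. | rewrite raddfD].
- by exists (shift i u), (shift i v); split; [exact: filt_shift.. | rewrite raddfD].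
Qed.

Lemma hol_scale A f a : hol A f -> hol A (a *: f).
Proof.
move=> [df [C hC]]; split; first by move=> k k' kk'; rewrite !fnZ (df _ _ kk').
exists C => K; apply: spanned_sub (hC K) => g hg; rewrite -[K]add0n.
by apply: filt_trans hg; apply: filtZ; apply: filt_base.
Qed.

Lemma hol_const c : hol [::] (fun=> c).
Proof.
split => //; exists 1%N => K; rewrite expn0 muln1.
exists unit, (fun=> fun=> 1); rewrite card_unit; split => // g hg.
suff [d ->] : exists d, g = fun=> d.
  exists (fun=> d); apply: funext => k.
  by rewrite big_const card_unit /= addr0 fnZ mulr1.
elim: hg => {K g} [|K a g h _ [d ->] _ [e ->]|K g _ //|//|//]; first by exists c.
by exists (a * d + e).
Qed.

Definition point (i b : nat) : fn := fun k => (k i == b)%:R.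

(** Multiplication only rescales a point mass and the shift moves it up by one, so words of length
    [K] stay in the span of the point masses at [0, ..., K]. *)
Lemma hol_delta i : hol [:: i] (point i 0%N).
Proof.
split; first by move=> k k' kk'; rewrite /point kk' ?mem_head.
exists 1%N => K; rewrite mul1n expn1.
exists 'I_K.+1, (fun b : 'I_K.+1 => point i b); rewrite card_ord; split => // g hg.
suff [c ->] : exists c : nat -> rat, g = \sum_(b < K.+1) c b *: point i b.
  by exists (fun b : 'I_K.+1 => c b).
have up L (c : nat -> rat) : \sum_(b < L.+1) c b *: point i b =
   \sum_(b < L.+2) (if (b < L.+1)%N then c b else 0) *: point i b :> fn.
  rewrite [RHS]big_ord_recr /= ltnn scale0r addr0; apply: eq_bigr => b _.
  by rewrite ltn_ord.
elim: hg => {K g} [|K a g h _ [c ->] _ [d ->]|K g _ [c ->]|K j g|K j g].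
- exists (fun=> 1); rewrite big_ord1 scale1r //.
- exists (fun b => a * c b + d b); rewrite scaler_sumr -big_split /=.
  by apply: eq_bigr => b _; rewrite scalerDl scalerA.
- by exists (fun b => if (b < K.+1)%N then c b else 0); apply: up.
- rewrite inE => /eqP -> _ [c ->].
  exists (fun b => b%:R * (if (b < K.+1)%N then c b else 0)).
  rewrite up linear_sum; apply: eq_bigr => b _; rewrite linearZ /=.
  apply: funext => k; rewrite !fnZ /mulv /point.
  by case: eqVneq => [->|_]; rewrite ?mulr1 ?mulr0 // mulrC.
- rewrite inE => /eqP -> _ [c ->].
  exists (fun b => c b.-1 *+ (b != 0)%N).
  rewrite linear_sum [RHS]big_ord_recl mulr0n scale0r add0r; apply: eq_bigr => b _.
  rewrite linearZ /=; congr (_ *: _); apply: funext => k.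
  by rewrite /shift /point; case: (k i) => // v; rewrite updE eqxx.
Qed.

(** * Identification of two variables *)

Lemma restr_mulv i j l h : l != i -> restr i j (mulv l h) = mulv l (restr i j h).
Proof.
by move=> li; apply: funext => k; rewrite /restr /mulv updE (negPf li).
Qed.

Lemma restr_shift i j l h : l != i -> l != j ->
  restr i j (shift l h) = shift l (restr i j h).
Proof.
move=> li lj; apply: funext => k; rewrite /restr /shift updE (negPf li).
case: (k l) => // v; rewrite updC 1?eq_sym // updE.
by rewrite [j == l]eq_sym (negPf lj).
Qed.

Lemma restr_shift_diag i j h : i != j ->
  restr i j (shift i (shift j h)) = shift j (restr i j h).
Proof.
move=> ij; apply: funext => k; rewrite /restr /shift !updE eqxx.
case E: (k j) => [|v] //.
by rewrite upd_upd !updE [j == i]eq_sym (negPf ij) E eqxx updC // upd_upd updC 1?eq_sym // upd_upd.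
Qed.

(** Once [i] and [j] are identified, a shift in [j] is the image of simultaneous shifts in [i] and
    [j]; this doubles the length of the word. *)
Lemma filt_restr A f i j K g : i \notin A -> j \in A ->
  filt A (restr i j f) K g ->
  exists2 h, filt (i :: A) f (K + K) h & g = restr i j h.
Proof.
move=> iA jA.
have ij : i != j by apply: contraNneq iA => ->.
have li l : l \in A -> l != i by apply: contraTneq => ->.
elim=> {K g} [|K a g1 g2 _ [h1 H1 ->] _ [h2 H2 ->]|K g _ [h H ->]
  |K l g lA _ [h H ->]|K l g lA _ [h H ->]].
- by exists f => //; apply: filt_base.
- by exists (a *: h1 + h2); [apply: filt_lin | rewrite linearP].
- by exists h => //; apply: filt_mono H; lia.
- exists (mulv l h); last by rewrite restr_mulv ?li.
  by rewrite addSn; apply: filt_mulv; [rewrite inE lA orbT | apply: filt_mono H; lia].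
- have lAi : l \in i :: A by rewrite inE lA orbT.
  rewrite addSn addnS; case: (eqVneq l j) => [->|lj].
    exists (shift i (shift j h)); last by rewrite restr_shift_diag.
    by do 2?[apply: filt_shift; rewrite ?mem_head // ?inE ?jA ?orbT //].
  exists (shift l h); last by rewrite restr_shift ?li.
  by apply: filt_up; apply: filt_shift.
Qed.

(* Multiplication by the falling factorial u(u-1)...(u-a+1), u = k_i - k_j. *)
Definition ffactv i j a (h : fn) : fn :=
  iteri a (fun b g => mulv i g - mulv j g - b%:R *: g) h.

Lemma ffactvE i j a h k :
  ffactv i j a h k = \prod_(b < a) ((k i)%:R - (k j)%:R - b%:R) * h k.
Proof.
elim: a => [|a IH]; first by rewrite big_ord0 mul1r.
rewrite big_ord_recr /ffactv /= -/(ffactv i j a h) !(fnD, fnN, fnZ) /mulv IH; ring.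
Qed.

Lemma filt_ffactv A f i j a K h : i \in A -> j \in A ->
  filt A f K h -> filt A f (a + K) (ffactv i j a h).
Proof.
move=> iA jA hh; elim: a => // a IH; rewrite addSn /ffactv /= -/(ffactv i j a h).
apply: filtB; last by apply: filtZ; apply: filt_up.
by apply: filtB; apply: filt_mulv.
Qed.

Lemma filt_iter_shift A f i a K h : i \in A ->
  filt A f K h -> filt A f (a + K) (iter a (shift i) h).
Proof. by move=> iA hh; elim: a => // a IH; rewrite addSn; apply: filt_shift. Qed.

Lemma iter_shiftE i a h k v : iter a (shift i) h (upd k i (v + a)) = h (upd k i v).
Proof.
elim: a => [|a IH]; first by rewrite addn0.
by rewrite /= {1}/shift updE eqxx addnS upd_upd.
Qed.

(* The family is triangular: with u = k_i - k_j, the function u(u-1)...(u-a+1) E_i^a h_s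
   vanishes on u = a' for a' < a and is a! times the restriction of h_s on u = a. *)
Lemma indep_ffactv (I : finType) i j K (h : I -> fn) : i != j ->
  indep (fun s => restr i j (h s)) ->
  indep (fun p : 'I_K * I => ffactv i j p.1 (iter p.1 (shift i) (h p.2))).
Proof.
move=> ij ind c c0.
suff S n (a : 'I_K) : a = n :> nat -> forall s, c (a, s) = 0 by case=> a s; apply: S.
elim/ltn_ind: n a => n IH a an.
apply: ind; apply: funext => k; rewrite fn0 fn_sum.
have := congr1 (fun F : fn => F (upd k i (k j + a)%N)) c0.
pose F (x : 'I_K) (y : I) :=
  (c (x, y) *: ffactv i j x (iter x (shift i) (h y))) (upd k i (k j + a)%N).
rewrite fn_sum fn0 (eq_bigr (fun p => F p.1 p.2)); last by case.
rewrite -pair_bigA {}/F /=.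
rewrite (bigD1 a) //= [X in _ + X]big1 ?addr0; last first.
  (* Blocks of smaller index have zero coefficients by induction; those of larger index contain the
     factor with [b = a], which is zero at this point. *)
  move=> a' a'a; apply: big1 => s _; rewrite fnZ ffactvE.
  case: (ltngtP a' a) => [lt|gt|E]; last by case/eqP: a'a; apply: val_inj.
  - by rewrite (IH a') ?mul0r -?an.
  rewrite (bigD1 (Ordinal gt)) //= !updE eqxx [j == i]eq_sym (negPf ij).
  by rewrite natrD [X in X * _ * _](_ : _ = 0) ?mul0r ?mulr0 //=; ring.
move=> E0.
have P0 : \prod_(b < a) ((k j + a)%:R - (k j)%:R - b%:R) != 0 :> rat.
  apply/prodf_neq0 => b _; rewrite natrD (_ : _ - _ = a%:R - b%:R) ?subr_eq0; last by ring.
  by rewrite eqr_nat gtn_eqF.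
apply: (mulfI P0); rewrite mulr0; apply: etrans E0; rewrite mulr_sumr; apply: eq_bigr => s _.
rewrite !fnZ ffactvE !updE eqxx [j == i]eq_sym (negPf ij) iter_shiftE.
by rewrite /restr mulrCA.
Qed.

(** With [d] variables in [A], [N] independent restrictions yield [(K + 1) N] independent functions
    upstairs, of filtration degree at most [4K]. So [(K + 1) N] is at most [C (4K + 1)^(d + 1)], and
    dividing by [K + 1] leaves the exponent [d]. *)
Lemma hol_restr A f i j : i \notin A -> j \in A -> hol (i :: A) f -> hol A (restr i j f).
Proof.
move=> iA jA [df [C hC]].
have ij : i != j by apply: contraNneq iA => ->.
split.
  move=> k k' kk'; apply: df => l; rewrite inE !updE; case: eqP => [_ _|_ /= lA]; exact: kk'.
exists (C * 4 ^ (size A).+1)%N => K; apply: spanned_of_indep => I g hg ind.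
have /boolp.choice[h hh] : forall s, exists h, filt (i :: A) f (K + K) h /\ g s = restr i j h.
  by move=> s; have [h H1 H2] := filt_restr iA jA (hg s); exists h.
have gE : g = (fun s => restr i j (h s)) by apply: funext => s; have [] := hh s.
rewrite {}gE in ind.
have iAi : i \in i :: A by rewrite mem_head.
have jAi : j \in i :: A by rewrite inE jA orbT.
have := indep_leq (hC (4 * K)%N) _ (indep_ffactv (K := K.+1) ij ind).
rewrite card_prod card_ord /= => le.
have {}le : (K.+1 * #|I| <= C * (4 * K).+1 ^ (size A).+1)%N.
  apply: le => -[a s] /=; apply: (@filt_mono _ _ (a + (a + (K + K)))%N).
    by have := ltn_ord a; lia.
  by apply: filt_ffactv => //; apply: filt_iter_shift => //; have [] := hh s.
rewrite -(leq_pmul2l (ltn0Sn K)); apply: leq_trans le _.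
rewrite mulnCA -expnS -mulnA -expnMn leq_mul2l leq_exp2r //.
by apply/orP; right; lia.
Qed.

(** * Inversion of recurrence operators *)

Definition shifts (w : seq nat) (h : fn) : fn := foldr shift h w.

Lemma shifts_linear w : linear (shifts w).
Proof. by elim: w => // i w IH a g h; rewrite /= IH linearP. Qed.
HB.instance Definition _ w :=
  GRing.isLinear.Build rat fn fn _ (shifts w) (shifts_linear w).

Lemma filt_shifts A f w K h : {subset w <= A} ->
  filt A f K h -> filt A f (size w + K) (shifts w h).
Proof.
elim: w => // i w IH wA hh; rewrite addSn; apply: filt_shift.
  by apply: wA; rewrite mem_head.
by apply: IH => // j jw; apply: wA; rewrite inE jw orbT.
Qed.

Lemma shiftC i j h : shift i (shift j h) = shift j (shift i h).
Proof.
case: (eqVneq i j) => [->//|ij]; apply: funext => k; rewrite /shift.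
case Ei: (k i) => [|v]; case Ej: (k j) => [|w] //; rewrite !updE ?Ei ?Ej.
- by rewrite (negPf ij).
- by rewrite eq_sym (negPf ij).
- by rewrite [j == i]eq_sym (negPf ij) updC.
Qed.

Lemma shift_shifts i w h : shift i (shifts w h) = shifts w (shift i h).
Proof. by elim: w => //= j w IH; rewrite shiftC IH. Qed.

Lemma shiftsC u w h : shifts u (shifts w h) = shifts w (shifts u h).
Proof. by elim: u => //= i u IH; rewrite IH shift_shifts. Qed.

Lemma mulv_shift i j h : mulv i (shift j h) = shift j (mulv i h) + (i == j)%:R *: shift j h.
Proof.
apply: funext => k; rewrite fnD fnZ /mulv /shift.
case E: (k j) => [|v]; first by rewrite !mulr0 addr0.
rewrite updE; case: eqVneq => [->|_]; last by rewrite mul0r addr0.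
by rewrite E mul1r -natr1 mulrDl mul1r.
Qed.

Lemma mulv_shifts i w h :
  mulv i (shifts w h) = shifts w (mulv i h) + (count_mem i w)%:R *: shifts w h.
Proof.
elim: w => [|j w IH]; first by rewrite scale0r addr0.
rewrite /= mulv_shift IH linearD linearZ /= natrD scalerDl eq_sym -addrA.
by congr (_ + _); rewrite addrC.
Qed.

Section Inverse.
Variables (A : seq nat) (t : nat) (ws : seq (seq nat)).
Hypothesis (tA : t \in A).
Hypothesis (wsA : {in ws, forall w, {subset w <= A}}).

(** The operator [1 - E_t(...)]: every word subtracted contains the shift in [t], so [h] can be
    recovered from its image by recurrence on [k t]. *)
Definition recop (h : fn) : fn := h - \sum_(w <- ws) shifts (t :: w) h.

(** The commutator of [recop] with multiplication by [k i]. *)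
Definition drecop i (h : fn) : fn :=
  \sum_(w <- ws) (count_mem i (t :: w))%:R *: shifts (t :: w) h.

Lemma recop_linear : linear recop.
Proof.
move=> a g h; rewrite /recop; under eq_bigr => w _ do rewrite linearP.
by rewrite big_split /= -scaler_sumr scalerBr opprD addrACA.
Qed.
HB.instance Definition _ := GRing.isLinear.Build rat fn fn _ recop recop_linear.

Lemma recop_shifts w h : recop (shifts w h) = shifts w (recop h).
Proof.
rewrite /recop [RHS]linearB [in RHS]linear_sum; congr (_ - _); apply: eq_bigr => v _.
exact: (shiftsC (t :: v)).
Qed.

Lemma recop_drecop i h : recop (drecop i h) = drecop i (recop h).
Proof.
rewrite /drecop linear_sum /=; apply: eq_bigr => w _.
by rewrite linearZ; congr (_ *: _); apply: (recop_shifts (t :: w)).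
Qed.

Lemma recop_mulv i h : recop (mulv i h) = mulv i (recop h) + drecop i h.
Proof.
rewrite /recop /drecop [X in _ = X + _]linearB [X in _ = (_ - X) + _]linear_sum -addrA; congr (_ + _).
rewrite -sumrN -[X in X + _]sumrN -big_split /=; apply: eq_bigr => w _.
by rewrite (mulv_shifts i (t :: w)) opprD addrNK.
Qed.

(** The commutator commutes with [recop], so multiplication passes through a power as in the Leibniz
    rule, using up one factor of [recop]. *)
Lemma iter_recop_mulv i m h :
  iter m.+1 recop (mulv i h) =
  mulv i (iter m.+1 recop h) + m.+1%:R *: drecop i (iter m recop h).
Proof.
elim: m => [|m IH]; first by rewrite /= recop_mulv scale1r.
rewrite iterS IH linearD linearZ /= recop_mulv recop_drecop -!iterS -addrA.
by congr (_ + _); rewrite -[m.+2]add1n natrD scalerDl scale1r.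
Qed.

Definition recdeg := (\sum_(w <- ws) size (t :: w))%N.

Lemma filt_term f K h w : w \in ws -> filt A f K h ->
  filt A f (recdeg + K) (shifts (t :: w) h).
Proof.
move=> wws hh; apply: (@filt_mono _ _ (size (t :: w) + K)%N).
  by rewrite leq_add2r /recdeg (big_rem w) //= leq_addr.
apply: filt_shifts => // i; rewrite inE => /orP[/eqP->//|]; exact: wsA.
Qed.

Lemma filt_recop f K h : filt A f K h -> filt A f (recdeg + K) (recop h).
Proof.
move=> hh; apply: filtB; first by apply: filt_mono hh; apply: leq_addl.
by rewrite big_seq; elim/big_rec: _ => [|w g /filt_term hw hg];
  [apply: filt0 | apply: filtD => //; apply: hw].
Qed.

Lemma filt_drecop f K i h : filt A f K h -> filt A f (recdeg + K) (drecop i h).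
Proof.
move=> hh; rewrite /drecop big_seq; elim/big_rec: _ => [|w g /filt_term hw hg];
  by [apply: filt0 | apply: filtD => //; apply: filtZ; apply: hw].
Qed.

(** Each letter of a word uses up at most one copy of [recop] in passing. With [K.+1] copies one is
    left to reach [h], and the length grows only linearly in [K]. *)
Lemma filt_iter_recop h K g : filt A h K g ->
  filt A (recop h) (recdeg.+1 * K.+1) (iter K.+1 recop g).
Proof.
elim=> {K g} [|K a g1 g2 _ H1 _ H2|K g _ H|K i g iA _ H|K i g iA _ H].
- by apply: filt_mono (filt_base _ _).
- have -> : forall m, iter m recop (a *: g1 + g2) = a *: iter m recop g1 + iter m recop g2.
    by elim=> // m IH; rewrite !iterS IH linearP.
  exact: filt_lin.
- by rewrite iterS; apply: filt_mono (filt_recop H); lia.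
- rewrite iter_recop_mulv; apply: filtD.
    apply: (@filt_mono _ _ (recdeg + recdeg.+1 * K.+1).+1); first by lia.
    by apply: filt_mulv => //; apply: filt_recop.
  by apply: filtZ; apply: filt_mono (filt_drecop i H); lia.
- have -> : forall m, iter m recop (shift i g) = shift i (iter m recop g).
    by elim=> // m IH; rewrite !iterS IH (recop_shifts [:: i]).
  apply: (@filt_mono _ _ (recdeg + recdeg.+1 * K.+1).+1); first by lia.
  by apply: filt_shift => //; apply: filt_recop.
Qed.

Lemma shifts_vanish n w h : (forall k : env, (k t < n)%N -> h k = 0) ->
  forall k : env, (k t < n)%N -> shifts w h k = 0.
Proof.
move=> h0; elim: w => //= i w IH k kn; rewrite /shift.
case E: (k i) => [|v] //; apply: IH; rewrite updE; case: eqP => // ti.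
by move: kn; rewrite ti E; apply: leq_trans.
Qed.

(** The equation [recop h = 0] expresses [h] through its values at smaller [k t], and forces it to
    vanish at [k t = 0]. *)
Lemma recop_inj h : recop h = 0 -> h = 0.
Proof.
move=> /eqP; rewrite subr_eq0 => /eqP hE.
suff S n (k : env) : (k t < n)%N -> h k = 0 by apply: funext => k; apply: (S (k t).+1).
elim: n k => // n IH k kn; rewrite hE fn_sum big1 // => w _ /=; rewrite /shift.
by case E: (k t) kn => [|v] // vn; apply: (shifts_vanish _ IH); rewrite updE eqxx.
Qed.

(** Powers of the injective [recop] preserve independence, so words of length [K] on [h] span no
    more than words of length linear in [K] on [recop h]. *)
Lemma hol_recop h : dep A h -> hol A (recop h) -> hol A h.
Proof.
move=> dh [_ [C hC]]; split => //.
exists (C * recdeg.+2 ^ size A)%N => K; apply: spanned_of_indep => I g hg ind.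
apply: (@leq_trans (C * (recdeg.+1 * K.+1).+1 ^ size A)%N); last first.
  rewrite -mulnA -expnMn leq_mul2l; apply/orP; right.
  have le : ((recdeg.+1 * K.+1).+1 <= recdeg.+2 * K.+1)%N by lia.
  by case: (size A) => // d; rewrite leq_exp2r.
apply: (indep_leq (h := fun s => iter K.+1 recop (g s)) (hC _)) => [s|c].
  exact: filt_iter_recop.
have S m : iter m recop (\sum_i c i *: g i) = \sum_i c i *: iter m recop (g i).
  elim: m => // m IH; rewrite iterS IH linear_sum /=.
  by apply: eq_bigr => s _; rewrite linearZ.
rewrite -S => c0; apply: ind.
by elim: K.+1 c0 => // m IH; rewrite iterS => /recop_inj.
Qed.

End Inverse.

(** * From holonomic functions of one variable to recurrences *)

Lemma iter_mulvE i a h k : iter a (mulv i) h k = (k i)%:R ^+ a * h k.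
Proof.
elim: a => [|a IH]; first by rewrite mul1r.
by rewrite iterS {1}/mulv IH exprS mulrA.
Qed.

Lemma hol_D_finite i (u : nat -> rat) : hol [:: i] (fun k => u (k i)) -> D_finite u.
Proof.
set f : fn := fun k => _ => -[_ [C hC]].
(* With this choice there are [4C^2 + 4C + 1] words, more than the bound [C (2K + 1) = 4C^2 + C] on
   the dimension. *)
pose K := (2 * C)%N.
pose b (p : 'I_K.+1 * 'I_K.+1) := iter p.1 (mulv i) (iter p.2 (shift i) f).
have bF p : filt [:: i] f (2 * K) (b p).
  apply: (@filt_mono _ _ (p.1 + (p.2 + 0))%N).
    by have := ltn_ord p.1; have := ltn_ord p.2; lia.
  have := filt_iter_shift p.2 (mem_head i [::]) (filt_base [:: i] f).
  rewrite /b; elim: (p.1 : nat) => // a IH hs; rewrite iterS addSn.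
  by apply: filt_mulv; [rewrite mem_head | apply: IH].
have /not_indep[c [c0 [[a0 b0] c00]]] : ~ indep b.
  move=> /(indep_leq (hC _) bF); rewrite card_prod card_ord expn1 /= /K; nia.
(* Evaluating the relation at [n + K] turns the [b]-fold backward shift into the term
   [f (n + K - b)]. Hence the reversed index and the argument [X + K]. *)
exists K, (fun j => \sum_(a < K.+1) c (a, rev_ord j) *: ('X + K%:R%:P) ^+ a); split.
  exists (rev_ord b0); rewrite rev_ordK.
  (* Substituting [X + K] is injective on polynomials, and [q] has the nonzero coefficient
     [c (a0, b0)]. *)
  pose q := \poly_(a < K.+1) c (inord a, b0).
  have -> : \sum_(a < K.+1) c (a, b0) *: ('X + K%:R%:P) ^+ a = q \Po ('X + K%:R%:P).
    rewrite /q poly_def linear_sum; apply: eq_bigr => a _ /=.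
    by rewrite linearZ /= comp_Xn_poly inord_val.
  rewrite comp_poly2_eq0 ?size_XaddC //.
  apply: contraNneq c00 => /(congr1 (fun p : {poly rat} => p`_a0)).
  by rewrite coef_poly coef0 ltn_ord inord_val => ->.
move=> n _.
have := congr1 (fun F : fn => F (upd (fun=> 0%N) i (n + K)%N)) c0.
pose t (x y : 'I_K.+1) := (c (x, y) *: b (x, y)) (upd (fun=> 0%N) i (n + K)%N).
rewrite fn_sum fn0 (eq_bigr (fun p => t p.1 p.2)); last by case.
rewrite -pair_bigA exchange_big (reindex_inj rev_ord_inj) /= => E0.
apply: etrans E0; apply: eq_bigr => j _.
rewrite horner_sum mulr_suml; apply: eq_bigr => a _.
rewrite /t fnZ /b iter_mulvE updE eqxx hornerZ horner_exp hornerD hornerX hornerC.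
rewrite natrD -mulrA; congr (_ * (_ * _)).
have -> : (n + K = n + j + rev_ord j)%N by have := ltn_ord j; rewrite /=; lia.
by rewrite iter_shiftE /f updE eqxx.
Qed.

(** * Partial sums and multiplication by a kernel *)

Lemma hol_filt A f K g : hol A f -> filt A f K g -> hol A g.
Proof.
move=> [df [C hC]] fg; split; first exact: filt_dep fg.
exists (C * K.+1 ^ size A)%N => L.
apply: (@spanned_leq (C * (K + L).+1 ^ size A)); last first.
  by apply: spanned_sub (hC _) => h; apply: filt_trans.
rewrite -mulnA -expnMn leq_mul2l; apply/orP; right.
by case: (size A) => // d; rewrite leq_exp2r //; nia.
Qed.

Lemma hol_shift A f i : i \in A -> hol A f -> hol A (shift i f).
Proof.
by move=> iA /hol_filt; apply; apply: filt_shift => //; apply: filt_base.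
Qed.

(** The constant 1 is the partial sum of the point mass at 0, that is, its image under the inverse
    of [1 - E_i]. *)
Lemma hol_one1 i : hol [:: i] (fun=> 1).
Proof.
apply: (@hol_recop _ i [:: [::]]) => //; rewrite ?mem_head //.
  by move=> w; rewrite inE => /eqP ->.
rewrite (_ : recop _ _ _ = point i 0%N); first exact: hol_delta.
apply: funext => k; rewrite /recop big_seq1 fnD fnN /= /shift /point.
by case: (k i) => [|v]; rewrite ?subr0 ?subrr.
Qed.

Lemma hol_one A : uniq A -> hol A (fun=> 1).
Proof.
elim: A => [_|i A IH /andP[iA uA]]; first exact: hol_const.
rewrite (_ : (fun=> 1) = fmul (fun=> 1) (fun=> 1)); last first.
  by apply: funext => k; rewrite /fmul mulr1.
apply: (@hol_tensor [:: i]) (hol_one1 i) (IH uA) => j.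
by rewrite inE => /eqP ->.
Qed.

(** The sum [S] below a bound [k i] satisfies [S - E_i S = E_i f]; afterwards the bound is
    identified with the variable [j]. *)
Lemma hol_sum_lt A i j f : i \notin A -> j \in A -> hol (i :: A) f ->
  hol A (fun k => \sum_(s < k j) f (upd k i s)).
Proof.
move=> iA jA hf.
rewrite (_ : (fun=> _) = restr i j (fun k => \sum_(s < k i) f (upd k i s))); last first.
  apply: funext => k; rewrite /restr updE eqxx.
  by apply: eq_bigr => s _; rewrite upd_upd.
apply: hol_restr => //; apply: (@hol_recop _ i [:: [::]]); rewrite ?mem_head //.
- by move=> w; rewrite inE => /eqP ->.
- move=> k k' kk'; rewrite (kk' i (mem_head _ _)); apply: eq_bigr => s _.
  by apply: hf.1 => l lA; rewrite !updE; case: eqP => // _; apply: kk'.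
rewrite (_ : recop _ _ _ = shift i f).
  by apply: hol_shift => //; apply: mem_head.
apply: funext => k; rewrite /recop big_seq1 fnD fnN /= /shift.
case: (k i) => [|v]; first by rewrite big_ord0 subr0.
rewrite updE eqxx big_ord_recr /=.
by under [X in _ - X]eq_bigr => s _ do rewrite upd_upd; rewrite addrAC subrr add0r.
Qed.

Definition hol3 (P : nat -> nat -> nat -> rat) : Prop :=
  forall t x y, uniq [:: t; x; y] -> hol [:: t; x; y] (fun k => P (k t) (k x) (k y)).

(** [P] is taken in three fresh variables, where the product is a tensor product; these are then
    identified with [t], [x], [y], which need not be distinct. *)
Lemma hol_mul3 P A f t x y : hol3 P -> t \in A -> x \in A -> y \in A ->
  hol A f -> hol A (fun k => P (k t) (k x) (k y) * f k).
Proof.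
move=> hP tA xA yA hf.
(* Larger than every element of [A], so each [m + j] is a fresh variable. *)
pose m := (\sum_(i <- A) i).+1.
have mA j : (m + j)%N \notin A.
  apply/negP => mjA; have : (m + j <= \sum_(i <- A) i)%N by rewrite (big_rem _ mjA) leq_addr.
  by rewrite /m addSn ltnNge leq_addr.
pose u := (m + 0)%N; pose v := (m + 1)%N; pose w := (m + 2)%N.
have uvw : uniq [:: u; v; w] by rewrite /= !inE /u /v /w !eqn_add2l.
have ne l j : l \in A -> (l == m + j)%N = false.
  by move=> lA; apply/negP => /eqP E; move: (mA j); rewrite -E lA.
have h0 : hol [:: u, v, w & A] (fmul (fun k => P (k u) (k v) (k w)) f).
  apply: (@hol_tensor [:: u; v; w]) => //; last exact: hP.
  by move=> i; rewrite !inE => /or3P[] /eqP ->; apply: mA.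
have h1 : hol A (restr w y (restr v x (restr u t (fmul (fun k => P (k u) (k v) (k w)) f)))).
  have wA : w \notin A by apply: mA.
  have vA : v \notin w :: A by rewrite inE negb_or mA /v /w eqn_add2l.
  have uA : u \notin [:: v, w & A].
    by rewrite !inE !negb_or mA /u /v /w !eqn_add2l.
  apply: hol_restr => //; apply: hol_restr => //; first by rewrite inE xA orbT.
  by apply: hol_restr => //; rewrite !inE tA !orbT.
congr (hol A _): h1; apply: funext => k; rewrite /restr /fmul.
have d := dep_upd _ _ (mA _) hf.1.
rewrite !d; congr (_ * _).
have [tv tw xw] : [/\ (t == v) = false, (t == w) = false & (x == w) = false].
  by split; apply: ne.
have [uv uw vw] : [/\ (u == v) = false, (u == w) = false & (v == w) = false].
  by rewrite /u /v /w !eqn_add2l.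
rewrite !updE !eqxx tv tw xw ![w == _]eq_sym ![v == u]eq_sym uv uw vw.
by [].
Qed.

(** * A holonomic kernel and nested sums of determinants *)

(* G t x.+1 y.+1 = sum_(p < t) 'C(p, x) * 'C(p, y); the index 0 is a dummy
   standing for a walker that is not yet born. *)
Fixpoint G (t x y : nat) : rat :=
  match t, x, y with
  | t'.+1, x'.+1, y'.+1 =>
      G t' x y + G t' x' y + G t' x y' + G t' x' y' + ((x' == 0) && (y' == 0))%N%:R
  | _, _, _ => 0
  end.

Lemma G0l t y : G t 0%N y = 0. Proof. by case: t. Qed.
Lemma G0r t x : G t x 0%N = 0. Proof. by case: t x => [|t] [|x]. Qed.

(** The recurrence says that [1 - E_t (1 + E_x) (1 + E_y)] maps [G] to a shifted product of a
    constant and two point masses. The predecessor on [t] is one more shift, as [G] vanishes at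
    [t = 0]. *)
Lemma hol3_G : hol3 (fun t => G t.-1).
Proof.
move=> t x y uA; have := uA; rewrite /= !inE negb_or !andbT => /andP[/andP[tx ty] xy].
have yt : (y == t) = false by rewrite eq_sym (negPf ty).
have xt : (x == t) = false by rewrite eq_sym (negPf tx).
have yx : (y == x) = false by rewrite eq_sym (negPf xy).
rewrite (_ : (fun=> _) = shift t (fun k => G (k t) (k x) (k y))); last first.
  apply: funext => k; rewrite /shift; case: (k t) => //= v.
  by rewrite !updE eqxx yt xt.
apply: hol_shift; first by rewrite mem_head.
apply: (@hol_recop _ t [:: [::]; [:: x]; [:: y]; [:: x; y]]); rewrite ?mem_head //.
- move=> w; rewrite !inE => /or4P[] /eqP -> // i; rewrite !inE.
  + by move=> ->; rewrite orbT.
  + by move=> ->; rewrite !orbT.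
  + by move=> /orP[] ->; rewrite !orbT.
- by move=> k k' kk'; rewrite !kk' // !inE eqxx ?orbT.
pose e := fmul (fun=> 1) (fmul (point x 0%N) (point y 0%N)).
have he : hol [:: t; x; y] e.
  apply: (@hol_tensor [:: t]); [|exact: hol_one1|apply: (@hol_tensor [:: x])].
  - by move=> i; rewrite !inE => /eqP ->; rewrite negb_or tx.
  - by move=> i; rewrite !inE => /eqP ->.
  - exact: hol_delta.
  - exact: hol_delta.
rewrite (_ : recop _ _ _ = shift t (shift x (shift y e))).
  by do 3?[apply: hol_shift]; rewrite // !inE eqxx ?orbT.
apply: funext => k; rewrite /recop !big_cons big_nil addr0 !(fnD, fnN) /= /shift.
have E := (eqxx, xt, yt, yx, negPf tx, negPf ty, negPf xy).
case Et: (k t) => [|v] /=; first by rewrite !addr0.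
case Ex: (k x) => [|a]; case Ey: (k y) => [|b];
  rewrite !(updE, E, Ex, Ey, G0l, G0r, addr0, subrr) //.
by rewrite /e /fmul /point !(updE, E) mul1r -natrM mulnb; ring.
Qed.

(** * Nested sums over decreasing sequences *)

Fixpoint decs (r b : nat) : seq (seq nat) :=
  if r is r'.+1 then flatten [seq [seq s :: l | l <- decs r' s] | s <- iota 0 b]
  else [:: [::]].

Fixpoint upds (k : env) (vs l : seq nat) : env :=
  match vs, l with
  | v :: vs', s :: l' => upds (upd k v s) vs' l'
  | _, _ => k
  end.

Lemma big_decsS r b (F : seq nat -> rat) :
  \sum_(l <- decs r.+1 b) F l = \sum_(s < b) \sum_(l <- decs r s) F (nat_of_ord s :: l).
Proof.
rewrite /= big_flatten big_map -(big_mkord xpredT (fun s => \sum_(l <- decs r s) F (s :: l))).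
by rewrite /index_iota subn0; apply: eq_bigr => s _; rewrite big_map.
Qed.

(** One partial summation for each variable of [vs]: the variables after [v] are summed first, below
    [k v], and then [v] below [k j]. *)
Lemma hol_decs vs A j f : uniq (vs ++ A) -> j \in A -> hol (vs ++ A) f ->
  hol A (fun k => \sum_(l <- decs (size vs) (k j)) f (upds k vs l)).
Proof.
elim: vs A j f => [|v vs IH] A j f uA jA hf.
  by congr (hol A _): hf; apply: funext => k; rewrite big_seq1.
have p : perm_eq ((v :: vs) ++ A) (vs ++ v :: A) by rewrite -cat1s -catA perm_catCA.
have := IH (v :: A) v f; rewrite -(perm_uniq p) => /(_ uA (mem_head _ _) (hol_perm p hf)).
have vA : v \notin A by move: uA; rewrite /= mem_cat negb_or => /andP[/andP[]].
move=> /(hol_sum_lt vA jA) h; congr (hol A _): h; apply: funext => k.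
by rewrite big_decsS; apply: eq_bigr => s _; rewrite updE eqxx.
Qed.

Lemma upds_notin k vs l v : v \notin vs -> upds k vs l v = k v.
Proof.
elim: vs k l => [|w vs IH] k [|s l] //=; rewrite inE negb_or => /andP[vw vvs].
by rewrite IH // updE (negPf vw).
Qed.

Lemma upds_nth k vs l i : uniq vs -> size l = size vs -> (i < size vs)%N ->
  upds k vs l (nth 0%N vs i) = nth 0%N l i.
Proof.
elim: vs k l i => [|v vs IH] k [|s l] [|i] //= /andP[vvs uvs] [sl] ivs.
  by rewrite upds_notin // updE eqxx.
exact: IH.
Qed.

Lemma size_decs r b l : l \in decs r b -> size l = r.
Proof.
elim: r b l => [|r IH] b l /=; first by rewrite inE => /eqP ->.
by move=> /flattenP[_ /mapP[s _ ->] /mapP[l' /IH <- ->]].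
Qed.

Lemma hol_sum A (I : finType) (F : I -> fn) : uniq A ->
  (forall i, hol A (F i)) -> hol A (\sum_i F i).
Proof.
move=> uA hF; elim/big_rec: _ => [|i g _]; last exact: hol_add.
rewrite -(scale0r (fun=> 1 : rat^o)); apply: hol_scale; exact: hol_one.
Qed.

Lemma hol_prod3 P A (I : finType) (t : nat) (x y : I -> nat) : hol3 P -> uniq A ->
  t \in A -> (forall i, x i \in A) -> (forall i, y i \in A) ->
  hol A (fun k => \prod_i P (k t) (k (x i)) (k (y i))).
Proof.
move=> hP uA tA xA yA.
rewrite (_ : (fun=> _) = fun k => \prod_(i <- index_enum I) P (k t) (k (x i)) (k (y i))) //.
elim: index_enum => [|i s IH].
  by congr (hol A _): (hol_one uA); apply: funext => k; rewrite big_nil.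
congr (hol A _): (hol_mul3 hP tA (xA i) (yA i) IH).
by apply: funext => k; rewrite big_cons.
Qed.

Theorem D_finite_sum_det r P : hol3 P ->
  D_finite (fun n => \sum_(l <- decs r n) \sum_(l' <- decs r n)
    \det (\matrix_(i < r, j < r) P n (nth 0%N l i) (nth 0%N l' j))).
Proof.
move=> hP.
(* Variable 0 stands for [n], variables [1, ..., r] for the entries of [l], and [r + 1, ..., 2r] for
   those of [l']. The Leibniz formula makes the determinant a finite sum of products of kernels. *)
pose vs := iota 1 r; pose vs' := iota r.+1 r.
have uA : uniq (vs ++ (vs' ++ [:: 0%N])).
  rewrite catA cats1 -iotaD rcons_uniq mem_iota /=; exact: iota_uniq.
have u' : uniq (vs' ++ [:: 0%N]) by move: uA; rewrite cat_uniq => /and3P[].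
pose F (s : 'S_r) : fn := fun k => \prod_(i < r) P (k 0%N) (k (nth 0%N vs i)) (k (nth 0%N vs' (s i))).
have hF : hol (vs ++ (vs' ++ [:: 0%N])) (\sum_(s : 'S_r) (-1) ^+ s *: F s).
  apply: hol_sum => // s; apply: hol_scale; apply: hol_prod3 => //.
  - by rewrite !mem_cat inE eqxx !orbT.
  - by move=> i; rewrite mem_cat mem_nth ?size_iota.
  - by move=> i; rewrite !mem_cat [X in _ || (X || _)]mem_nth ?size_iota ?orbT.
have h0 : 0%N \in vs' ++ [:: 0%N] by rewrite mem_cat inE eqxx orbT.
have := hol_decs u' (mem_head 0%N [::]) (hol_decs uA h0 hF).
set g : fn := fun k => _ => hg; apply: (@hol_D_finite 0%N).
congr (hol _ _): hg; apply: funext => k; rewrite /g {g} !size_iota.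
have n0 : 0%N \notin vs' by rewrite mem_iota.
under eq_bigr => l' _ do rewrite upds_notin //.
rewrite exchange_big /=.
apply: eq_big_seq => l /size_decs sl; apply: eq_big_seq => l' /size_decs sl'.
rewrite fn_sum; apply: eq_bigr => s _; rewrite fnZ; congr (_ * _).
apply: eq_bigr => i _; rewrite mxE upds_notin ?mem_iota // upds_notin //.
have dj v : v \in vs' -> v \notin vs by rewrite !mem_iota; lia.
rewrite upds_nth ?iota_uniq ?size_iota // upds_notin ?dj ?mem_nth ?size_iota //.
by rewrite upds_nth ?iota_uniq ?size_iota.
Qed.

(** * Walks of non-intersecting walkers *)

Lemma det_expand_rows (r : nat) (T : finType) (p : 'I_r -> pred T) (E : 'I_r -> T -> 'I_r -> rat) :
  \det (\matrix_(i, j) \sum_(a | p i a) E i a j) =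
  \sum_(z : {ffun 'I_r -> T} | [forall i, p i (z i)]) \det (\matrix_(i, j) E i (z i) j).
Proof.
rewrite /determinant exchange_big /=; apply: eq_bigr => s _.
rewrite -big_distrr /=; congr (_ * _).
under eq_bigr => i _ do rewrite mxE.
rewrite (bigA_distr_big_dep p (fun i a => E i a (s i))) /=.
by apply: eq_bigr => z _; apply: eq_bigr => i _; rewrite mxE.
Qed.

Lemma det_row0 r (M : 'M[rat]_r) i : (forall j, M i j = 0) -> \det M = 0.
Proof. by move=> M0; rewrite (expand_det_row _ i) big1 // => j _; rewrite M0 mul0r. Qed.

Lemma uniq_flatten_cons (T : eqType) (f : T -> seq (seq T)) (e : seq T) : uniq e ->
  (forall x, uniq (f x)) -> uniq (flatten [seq [seq x :: p | p <- f x] | x <- e]).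
Proof.
move=> + uf; elim: e => //= x e IH /andP[xe ue]; rewrite cat_uniq IH // andbT.
rewrite map_inj_uniq ?uf => [|p q [] //]; apply/hasPn => q /flattenP[_ /mapP[y ye ->]].
by move=> /mapP[p _ ->]; apply/mapP => -[p' _ [E _]]; rewrite -E ye in xe.
Qed.

Section Walks.
Variables (r n : nat).
Notation vec := {ffun 'I_r -> 'I_n.+1}.
Implicit Types (x z : vec) (s : vec * vec).

(* Positions are shifted by one: 0 means absorbed (not yet born, in the backward
   reading), so [good] asks for strict decrease among the live walkers only. *)
Definition good x := [forall i : 'I_r, forall j : 'I_r, (i < j)%N ==> (x j < x i)%N || (x j == 0 :> nat)].

Definition stp (u a : nat) := (a == u) || (a.+1 == u).

Definition step x z := [forall i, stp (x i) (z i)].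

(** The two families describe the triangles on either side of the same diagonal, so they must have
    the same live walkers. *)
Definition ok s := [&& good s.1, good s.2 & [forall i, (s.1 i == 0 :> nat) == (s.2 i == 0 :> nat)]].

(* The coordinates that have reached 0 contribute an identity block. *)
Definition entry t (i : 'I_r) (a : nat) (j : 'I_r) (b : nat) : rat :=
  G t a b + [&& a == 0%N, b == 0%N & i == j]%:R.

Definition wmat t s : 'M[rat]_r := \matrix_(i, j) entry t i (s.1 i) j (s.2 j).

Lemma sum_stp (u : 'I_n.+1) (F : nat -> rat) :
  \sum_(a : 'I_n.+1 | stp u a) F a = F u + (if (u : nat) is v.+1 then F v else 0).
Proof.
rewrite (bigD1 u) /=; last by rewrite /stp eqxx.
congr (_ + _); case: u => [[|v] vn] /=.
  by apply: big_pred0 => a; rewrite /stp -val_eqE /= orbF andbN.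
rewrite (big_pred1 (Ordinal (ltnW vn))) // => -[a an].
transitivity (((a == v.+1) || (a.+1 == v.+1)) && (a != v.+1)); first by [].
transitivity (a == v); [lia | by []].
Qed.

Lemma goodP x (i j : 'I_r) : good x -> (i < j)%N -> x j != 0 :> nat -> (x j < x i)%N.
Proof. by move=> /forallP/(_ i)/forallP/(_ j)/implyP gx ij; case/orP: (gx ij) => // ->. Qed.

Lemma entryS t s i j : ok s ->
  entry t.+1 i (s.1 i) j (s.2 j) =
  \sum_(a : 'I_n.+1 | stp (s.1 i) a) \sum_(b : 'I_n.+1 | stp (s.2 j) b) entry t i a j b.
Proof.
case: s => x y /and3P[/= gx gy /forallP sup].
rewrite (sum_stp _ (fun a => \sum_(b : 'I_n.+1 | stp (y j) b) entry t i a j b)).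
rewrite (sum_stp _ (fun b => entry t i (x i) j b)).
have sup' l : (x l == 0 :> nat) = (y l == 0 :> nat) := eqP (sup l).
case Ex: (x i : nat) => [|a].
  rewrite addr0 /entry !G0l !add0r eqxx /=; case Ey: (y j : nat) => [|b]; first by rewrite addr0.
  rewrite G0l !add0r; case: (eqVneq i j) => [ij|]; last by rewrite !andbF.
  by move: (sup' i); rewrite Ex {1}ij Ey.
rewrite (sum_stp _ (fun b => entry t i a j b)) /entry.
case Ey: (y j : nat) => [|b].
  rewrite !G0r /= !addr0 !add0r; case: (eqVneq i j) => [ij|]; last by rewrite andbF.
  by move: (sup' j); rewrite Ey -ij Ex.
rewrite /= !addr0 !andbF !addr0.
(* The source term of [G] must match the identity block. A walker at position 1 is the last live one
   of its family, and both families have the same live indices, so [i = j]. *)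
have -> : (a == 0) && (b == 0) = [&& a == 0, b == 0 & i == j]%N.
  case: eqVneq => //= a0; case: eqVneq => //= b0; apply/esym/eqP/val_inj => /=.
  case: (ltngtP i j) => // ij.
    by have := goodP gx ij; rewrite sup' Ey Ex a0 ltnS leqn0 sup' Ey => /(_ isT).
  by have := goodP gy ij; rewrite -(sup' i) Ex Ey b0 ltnS leqn0 -(sup' i) Ex => /(_ isT).
ring.
Qed.

Lemma det_wmat_degen t s (i j : 'I_r) : (i < j)%N -> s.1 i = s.1 j -> s.1 j != 0 :> nat ->
  \det (wmat t s) = 0.
Proof.
move=> ij e nz; apply: (@determinant_alternate _ _ _ i j); first by rewrite neq_ltn ij.
by move=> k; rewrite !mxE /entry e (negPf nz).
Qed.

Lemma entryC t i a j b : entry t i a j b = entry t j b i a.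
Proof.
rewrite /entry; congr (_ + _); last by rewrite andbCA [j == i]eq_sym.
elim: t a b => // t IH [|a] [|b] //=.
by rewrite [(a == _) && _]andbC (IH a.+1 b.+1) (IH a b.+1) (IH a.+1 b) (IH a b); ring.
Qed.

Lemma wmat_tr t x y : (wmat t (x, y))^T = wmat t (y, x).
Proof. by apply/matrixP => i j; rewrite !mxE entryC. Qed.

(** Walkers move down by at most one, so a strict order can only fail through a collision, which
    gives two equal rows. *)
Lemma det_wmat_bad_step t x z y : good x -> step x z -> ~~ good z ->
  \det (wmat t (z, y)) = 0.
Proof.
move=> gx /forallP xz; rewrite negb_forall => /existsP[i].
rewrite negb_forall => /existsP[j]; rewrite negb_imply negb_or => /and3P[ij le nz].
apply: (@det_wmat_degen _ _ i j) => //=; apply: val_inj => /=.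
have := goodP gx ij; have := xz i; have := xz j; move: le nz; rewrite /stp; lia.
Qed.

(** The row or column of an absorbed walker is zero when its partner is still alive. *)
Lemma det_wmat_sup t s i : (s.1 i == 0 :> nat) != (s.2 i == 0 :> nat) ->
  \det (wmat t s) = 0.
Proof.
case: s => x y /= ne.
wlog xi : x y ne / x i == 0 :> nat => [IH|].
  case xi: (x i == 0 :> nat); first exact: IH.
  by rewrite -det_tr wmat_tr; apply: IH; [rewrite eq_sym | move: ne; rewrite xi; case: (y i == 0%N :> nat)].
apply: (@det_row0 _ _ i) => j; rewrite mxE /entry /= (eqP xi) G0l add0r eqxx /=.
case: (eqVneq i j) => [<-|]; last by rewrite andbF.
by move: ne; rewrite xi; case: (y i == 0%N :> nat).
Qed.

Definition step2 s s' := step s.1 s'.1 && step s.2 s'.2.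

(** An argument in the style of Lindström, Gessel and Viennot: expanding by multilinearity in rows
    and then columns gives all pairs of steps, and those leading outside [ok] contribute zero
    determinants. *)
Lemma det_wmatS t s : ok s ->
  \det (wmat t.+1 s) = \sum_(s' | ok s' && step2 s s') \det (wmat t s').
Proof.
move=> oks; have /and3P[g1 g2 _] := oks.
have -> : wmat t.+1 s = \matrix_(i, j)
   \sum_(a : 'I_n.+1 | stp (s.1 i) a) \sum_(b : 'I_n.+1 | stp (s.2 j) b) entry t i a j b.
  by apply/matrixP => i j; rewrite !mxE entryS.
rewrite (det_expand_rows (fun i (a : 'I_n.+1) => stp (s.1 i) a)).
transitivity (\sum_(x | step s.1 x) \sum_(y | step s.2 y) \det (wmat t (x, y))).
  apply: eq_bigr => x _; rewrite -det_tr.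
  pose E j (b : 'I_n.+1) i := entry t i (x i) j b.
  rewrite (_ : _^T = \matrix_(j, i) \sum_(b : 'I_n.+1 | stp (s.2 j) b) E j b i).
    rewrite (det_expand_rows (fun j (b : 'I_n.+1) => stp (s.2 j) b)); apply: eq_bigr => y _.
    by rewrite -det_tr; congr (\det _); apply/matrixP => i j; rewrite !mxE.
  by apply/matrixP => j i; rewrite !mxE.
rewrite pair_big /= big_mkcond [RHS]big_mkcond; apply: eq_bigr => -[x y] _ /=.
rewrite /step2 /=; case: ifP => [/andP[sx sy]|_]; last by rewrite andbF.
rewrite andbT; case: ifP => // /negbT; rewrite /ok /= !negb_and => /or3P[bx|bY|].
- exact: det_wmat_bad_step sx bx.
- by rewrite -det_tr wmat_tr; apply: det_wmat_bad_step sy bY.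
- by rewrite negb_forall => /existsP[i] ne; apply: (@det_wmat_sup t (x, y) i).
Qed.

Definition zerov : vec := [ffun=> ord0].
Definition zeros := (zerov, zerov).

Lemma det_wmat0 s : ok s -> \det (wmat 0 s) = (s == zeros)%:R.
Proof.
move=> /and3P[_ _ /forallP sup]; case: eqVneq => [->|ne].
  rewrite (_ : wmat _ _ = 1%:M) ?det1 //.
  by apply/matrixP => i j; rewrite !mxE /entry /= !ffunE add0r eqxx.
have [i xi] : exists i, s.1 i != 0 :> nat.
  apply/existsP; apply: contraNT ne; rewrite negb_exists => /forallP x0.
  have e1 i : s.1 i = ord0 by apply: val_inj; have := x0 i; rewrite negbK => /eqP.
  have e2 i : s.2 i = ord0.
    by apply: val_inj => /=; apply/eqP; rewrite -(eqP (sup i)) e1.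
  by case: s e1 e2 {sup x0} => x y /= e1 e2; rewrite /zeros xpair_eqE;
    apply/andP; split; apply/eqP/ffunP => i; rewrite ffunE.
by apply: (@det_row0 _ _ i) => j; rewrite mxE /entry add0r (negPf xi).
Qed.

(** The starting state [s] is not recorded in the list. *)
Fixpoint walks t s : seq (seq (vec * vec)) :=
  if t is t'.+1 then
    flatten [seq [seq s' :: p | p <- walks t' s'] | s' <- enum [pred s' | ok s' && step2 s s']]
  else if s == zeros then [:: [::]] else [::].

Lemma size_walks t s : ok s -> (size (walks t s))%:R = \det (wmat t s).
Proof.
elim: t s => [|t IH] s oks; first by rewrite det_wmat0 //=; case: eqP.
rewrite det_wmatS //= size_flatten /shape -map_comp sumnE big_map big_enum natr_sum.
by apply: eq_bigr => s' /andP[oks' _]; rewrite /= size_map IH.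
Qed.

Lemma mem_walks t s p : (p \in walks t s) =
  [&& size p == t, path (fun s s' => ok s' && step2 s s') s p & last s p == zeros].
Proof.
elim: t s p => [|t IH] s p /=.
  case: p => [|s' p]; last by case: ifP; rewrite ?inE.
  by case: ifP; rewrite ?inE.
apply/flattenP/idP => [[_ /mapP[s' s'e ->] /mapP[q]]|].
  by rewrite IH => /and3P[sq pq lq] ->; move: s'e; rewrite mem_enum inE /= eqSS sq pq lq => ->.
case: p => [|s' p] //=; rewrite eqSS => /and3P[sp /andP[ss' pp] lp].
exists [seq s' :: q | q <- walks t s']; first by apply: map_f; rewrite mem_enum inE.
by apply: map_f; rewrite IH sp pp.
Qed.

Lemma uniq_walks t s : uniq (walks t s).
Proof.
elim: t s => [|t IH] s /=; first by case: ifP.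
by apply: uniq_flatten_cons; rewrite ?enum_uniq.
Qed.

Definition start s := ok s && [forall i, s.1 i != 0 :> nat].

(** There are [n] steps through [n + 1] states, one for each diagonal entry of an array of size
    [n + 1]. *)
Definition full_walks : seq (seq (vec * vec)) :=
  flatten [seq [seq s :: p | p <- walks n s] | s <- enum start].

Lemma uniq_full_walks : uniq full_walks.
Proof. by apply: uniq_flatten_cons; [apply: enum_uniq | apply: uniq_walks]. Qed.

Lemma mem_full_walks q : q \in full_walks <->
  [/\ size q = n.+1, start (nth zeros q 0%N), nth zeros q n = zeros,
      forall i, (i <= n)%N -> ok (nth zeros q i) &
      forall i, (i < n)%N -> step2 (nth zeros q i) (nth zeros q i.+1)].
Proof.
split.
  move=> /flattenP[_ /mapP[s + ->] /mapP[p + ->]]; rewrite mem_enum mem_walks => st.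
  move=> /and3P[/eqP sp /(pathP zeros) pp /eqP lp]; split => //=.
  - by rewrite sp.
  - by move: lp; rewrite (last_nth zeros) sp.
  - by case=> [_|i il]; [case/andP: st | rewrite -sp in il; case/andP: (pp i il)].
  - by move=> i il; rewrite -sp in il; case/andP: (pp i il).
case: q => [|s p] [] //= [sp] st sl oks steps; apply/flattenP.
exists [seq s :: p | p <- walks n s]; first by apply: map_f; rewrite mem_enum.
apply: map_f; rewrite mem_walks sp eqxx (last_nth zeros) sp sl eqxx andbT.
apply/(pathP zeros) => i; rewrite sp => il.
by rewrite (oks i.+1 il) (steps i il).
Qed.

Lemma size_full_walks :
  (size full_walks)%:R = \sum_(s | start s) \det (wmat n s).
Proof.
rewrite size_flatten /shape -map_comp sumnE big_map big_enum natr_sum.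
by apply: eq_bigr => s /andP[oks _]; rewrite /= size_map size_walks.
Qed.

Definition sdec x := [forall i : 'I_r, forall j : 'I_r, (i < j)%N ==> (x j < x i)%N].

Lemma sum_start : \sum_(s | start s) \det (wmat n s) =
  \sum_(x | sdec x) \sum_(y | sdec y) \det (\matrix_(i, j) G n (x i) (y j)).
Proof.
have pos x y : [forall i, x i != 0 :> nat] -> wmat n (x, y) = \matrix_(i, j) G n (x i) (y j).
  move=> /forallP x0; apply/matrixP => i j; rewrite !mxE /entry /= (negPf (x0 i)).
  by rewrite addr0.
have zero (x y : vec) i : x i = 0 :> nat -> \det (\matrix_(i, j) G n (x i) (y j)) = 0.
  by move=> x0; apply: (@det_row0 _ _ i) => j; rewrite mxE x0 G0l.
have zero' (x y : vec) i : y i = 0 :> nat -> \det (\matrix_(i, j) G n (x i) (y j)) = 0.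
  by move=> y0; rewrite -det_tr; apply: (@det_row0 _ _ i) => j; rewrite !mxE y0 G0r.
rewrite [RHS]pair_big /= big_mkcond [RHS]big_mkcond; apply: eq_bigr => -[x y] _ /=.
have goodE z : [forall i, z i != 0 :> nat] -> good z = sdec z.
  move=> /forallP z0; apply: eq_forallb => i; apply: eq_forallb => j.
  by rewrite (negPf (z0 j)) orbF.
case: (boolP [forall i, x i != 0 :> nat]) => [x0|]; last first.
  rewrite negb_forall => /existsP[i]; rewrite negbK => /eqP xi.
  by rewrite /start /= (zero x y i xi) if_same ifF //; apply/negP => /andP[_ /forallP/(_ i)]; rewrite xi.
case: (boolP [forall i, y i != 0 :> nat]) => [y0|]; last first.
  rewrite negb_forall => /existsP[i]; rewrite negbK => /eqP yi.
  rewrite (zero' x y i yi) if_same ifF //; apply/negP => /andP[/and3P[_ _ /forallP/(_ i)]] /=.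
  by rewrite yi eqxx (negPf (forallP x0 i)).
rewrite /start /ok /= x0 !goodE // pos // !andbT.
suff -> : [forall i, (x i == 0 :> nat) == (y i == 0 :> nat)] by rewrite andbT.
by apply/forallP => i; rewrite (negPf (forallP x0 i)) (negPf (forallP y0 i)).
Qed.

End Walks.

(** * Arrays as pairs of walks *)

Lemma mem_decs k b l :
  (l \in decs k b) = (size l == k) && path (fun u v => v < u)%N b l.
Proof.
elim: k b l => [|k IH] b l /=; first by rewrite inE; case: l.
apply/flattenP/idP => [[_ /mapP[s + ->] /mapP[p + ->]]|].
  by rewrite mem_iota IH /= eqSS add0n => -> /andP[-> ->].
case: l => [|s l] //=; rewrite eqSS => /and3P[sl sb pl].
exists [seq s :: l | l <- decs k s]; first by apply: map_f; rewrite mem_iota.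
by apply: map_f; rewrite IH sl.
Qed.

Lemma uniq_decs k b : uniq (decs k b).
Proof.
elim: k b => [|k IH] b //=.
by apply: uniq_flatten_cons; [apply: iota_uniq | move=> s; apply: IH].
Qed.

Definition vlist r n (x : {ffun 'I_r -> 'I_n.+1}) : seq nat := [seq (x i : nat) | i <- enum 'I_r].

Lemma nth_vlist r n (x : {ffun 'I_r -> 'I_n.+1}) (i : 'I_r) : nth 0%N (vlist x) i = x i.
Proof. by rewrite /vlist (nth_map i) ?size_enum_ord // nth_ord_enum. Qed.

Lemma big_sdec r n (F : seq nat -> rat) :
  \sum_(x : {ffun 'I_r -> 'I_n.+1} | sdec x) F (vlist x) = \sum_(l <- decs r n.+1) F l.
Proof.
rewrite -big_enum -(big_map (@vlist r n) xpredT F) /=; apply: perm_big.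
apply: uniq_perm; rewrite ?uniq_decs //.
  rewrite map_inj_uniq ?enum_uniq // => x y xy; apply/ffunP => i; apply: val_inj.
  by rewrite /= -!nth_vlist xy.
move=> l; rewrite mem_decs; apply/mapP/andP => [[x + ->]|[/eqP sl pl]].
  rewrite mem_enum => /forallP dx; split; first by rewrite size_map size_enum_ord.
  apply/(pathP 0%N) => i; rewrite size_map size_enum_ord => ir.
  have -> : nth 0%N (vlist x) i = x (Ordinal ir) by rewrite -nth_vlist.
  case: i ir => [|i] ir /=; first exact: ltn_ord.
  have -> : nth 0%N (vlist x) i = x (Ordinal (ltnW ir)) by rewrite -nth_vlist.
  by have /forallP/(_ (Ordinal ir))/implyP := dx (Ordinal (ltnW ir)); apply => /=.
have tr : transitive (fun u v => v < u)%N by move=> u v w uv wu; apply: ltn_trans wu uv.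
have lb i : (i < r)%N -> (nth 0%N l i < n.+1)%N.
  by move=> ir; have /allP := order_path_min tr pl; apply; rewrite mem_nth ?sl.
exists [ffun i : 'I_r => inord (nth 0%N l i)]; last first.
  apply: (@eq_from_nth _ 0%N); first by rewrite size_map size_enum_ord sl.
  move=> i; rewrite sl => ir; rewrite -[X in _ = nth _ _ X]/(nat_of_ord (Ordinal ir)).
  by rewrite nth_vlist ffunE inordK ?lb.
rewrite mem_enum; apply/forallP => i; apply/forallP => j; apply/implyP => ij.
rewrite !ffunE !inordK ?lb //.
by apply: (sorted_ltn_nth tr 0%N (path_sorted pl)); rewrite ?inE ?sl.
Qed.

(** * Conjugate partitions: deficits and walker positions *)

Lemma card_ltn_ord r k : (k <= r)%N -> #|[pred i : 'I_r | (i < k)%N]| = k.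
Proof. by move=> kr; rewrite -sum1_card (big_ord_narrow kr) sum1_card card_ord. Qed.

(** A downward closed set of ordinals is an initial segment, so its cardinality decides
    membership. *)
Lemma ltn_card_down r (P : pred 'I_r) (i : 'I_r) :
  (forall j k : 'I_r, (j <= k)%N -> P k -> P j) -> (i < #|P|)%N = P i.
Proof.
move=> dP; apply/idP/idP => [|Pi]; last first.
  rewrite -[i.+1](@card_ltn_ord r) //; apply: subset_leq_card; apply/fintype.subsetP => j.
  by rewrite !inE ltnS => /dP; apply.
apply: contraTT => Pi; rewrite -leqNgt -[X in (_ <= X)%N](card_ltn_ord (ltnW (ltn_ord i))).
apply: subset_leq_card; apply/fintype.subsetP => j; rewrite !inE ltnNge => Pj.
by apply: contra Pi => /dP; apply.
Qed.

(* a i d stands for r minus the deficit at the (0-based) position (i, i + d); a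
   second such function describes the positions (i + d, i). *)
Definition side n (a : nat -> nat -> nat) : Prop :=
  [/\ forall i d, (i + d < n)%N -> (a i d.+1 <= a i d <= (a i d.+1).+1)%N,
      forall i d, (i + d < n)%N -> (a i d.+1 <= a i.+1 d <= (a i d.+1).+1)%N,
      forall i d, (i + d < n)%N -> (a i.+1 d <= a i d <= (a i.+1 d).+1)%N
    & a n 0%N = 0%N].

Section Ladders.
Variables (r n : nat).
Notation vec := {ffun 'I_r -> 'I_n.+1}.

Definition ladder (X : nat -> vec) : Prop :=
  [/\ forall i, (i <= n)%N -> good (X i),
      forall i, (i < n)%N -> step (X i) (X i.+1) & X n = zerov r n].

(* Row i of [a] and the walker positions X i are conjugate partitions:
   m < a i d iff d < X i m. *)
Definition cnt (x : vec) (d : nat) : nat := #|[pred m : 'I_r | (d < x m)%N]|.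

Lemma cnt_lt (x : vec) d (m : 'I_r) : good x -> (m < cnt x d)%N = (d < x m)%N.
Proof.
move=> gx; rewrite ltn_card_down // => j k; rewrite leq_eqVlt => /orP[/eqP/val_inj->//|jk].
by move=> /= dk; apply: (ltn_trans dk (goodP gx jk _)); rewrite -lt0n (leq_ltn_trans _ dk).
Qed.

Lemma cnt_leq (x y : vec) d e : (forall m, (d < x m)%N -> (e < y m)%N) -> (cnt x d <= cnt y e)%N.
Proof. by move=> h; apply: subset_leq_card; apply/fintype.subsetP => m; apply: h. Qed.

(** Otherwise the walkers with indices [cnt y e] and [cnt y e + 1] are both beyond [d] in [x]; the
    hypothesis puts the first one beyond [e] in [y], contradicting the count. *)
Lemma cnt_leqS (x y : vec) d e : good x -> good y ->
  (forall m m' : 'I_r, (m < m')%N -> (d < x m')%N -> (e < y m)%N) ->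
  (cnt x d <= (cnt y e).+1)%N.
Proof.
move=> gx gy h; rewrite leqNgt; apply/negP => lt.
have xr : (cnt x d <= r)%N by rewrite -[X in (_ <= X)%N]card_ord max_card.
have m'r := leq_trans lt xr.
have := h (Ordinal (ltnW m'r)) (Ordinal m'r) (ltnSn _).
by rewrite -cnt_lt // => /(_ lt); rewrite -cnt_lt //= ltnn.
Qed.

Lemma stepP (x z : vec) m : step x z -> (z m <= x m <= (z m).+1)%N.
Proof. by move=> /forallP/(_ m); rewrite /stp => /orP[/eqP->|/eqP<-]; rewrite !leqnn ?leqnSn. Qed.

Lemma side_cnt X : ladder X -> side n (fun i d => cnt (X i) d).
Proof.
move=> [gX sX X0]; split.
- move=> i d id; have gi : good (X i) by apply: gX; lia.
  apply/andP; split; first by apply: cnt_leq => m; apply: ltn_trans.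
  apply: cnt_leqS => // m m' mm' dm'; have := goodP gi mm'; lia.
- move=> i d id; have gi : good (X i) by apply: gX; lia.
  have gi' : good (X i.+1) by apply: gX; lia.
  have st m : (X i.+1 m <= X i m <= (X i.+1 m).+1)%N by apply: stepP; apply: sX; lia.
  apply/andP; split; first by apply: cnt_leq => m; have := st m; lia.
  apply: cnt_leqS => // m m' mm' dm'; have := goodP gi mm'; have := st m'; lia.
- move=> i d id; have gi : good (X i) by apply: gX; lia.
  have gi' : good (X i.+1) by apply: gX; lia.
  have st m : (X i.+1 m <= X i m <= (X i.+1 m).+1)%N by apply: stepP; apply: sX; lia.
  apply/andP; split; first by apply: cnt_leq => m; have := st m; lia.
  apply: cnt_leqS => // m m' mm' dm'; have := goodP gi mm'; have := st m; lia.
- by rewrite X0; apply: eq_card0 => m; rewrite inE ffunE.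
Qed.

Lemma ladder_leq X i m : ladder X -> (i <= n)%N -> (X i m <= n - i)%N.
Proof.
move=> [_ sX X0] /subKn <-; elim: (n - i)%N (leq_subr i n) => [|t IH] tn.
  by rewrite subn0 X0 ffunE.
have /sX/(stepP m) : (n - t.+1 < n)%N by lia.
have -> : ((n - t.+1).+1 = n - t)%N by lia.
have := IH (ltnW tn); lia.
Qed.

(** Only the counts inside the array are compared. They suffice because [n - i] steps remain before
    absorption, so no walker at time [i] exceeds [n - i]. *)
Lemma ladder_inj X Y : ladder X -> ladder Y ->
  (forall i d, (i + d <= n)%N -> cnt (X i) d = cnt (Y i) d) ->
  forall i, (i <= n)%N -> X i = Y i.
Proof.
move=> lX lY XY i iN.
have half X' Y' m : ladder X' -> ladder Y' ->
  (forall d, (i + d <= n)%N -> cnt (X' i) d = cnt (Y' i) d) -> (X' i m <= Y' i m)%N.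
  move=> lX' lY' E; rewrite leqNgt; apply/negP => lt.
  have gX : good (X' i) by case: lX' => g _ _; apply: g.
  have gY : good (Y' i) by case: lY' => g _ _; apply: g.
  have := ladder_leq m lX' iN.
  move: (lt); rewrite -cnt_lt // => + le; rewrite E ?cnt_lt ?ltnn //; lia.
apply/ffunP => m; apply/val_inj/eqP; rewrite /= eqn_leq.
by rewrite !half // => d id; rewrite ?XY // -XY.
Qed.

Lemma side_last a i d : side n a -> (i + d)%N = n -> a i d = 0%N.
Proof.
move=> [_ h _ a0]; elim: d i => [|d IH] i id.
  by have -> : i = n by lia.
by have := h i d; rewrite (IH i.+1); lia.
Qed.

(** This yields the band rule: [a] decreases along rows and along the diagonal, so it stays between
    0 and its value at the first corner. *)
Lemma side_leq0 a i d : side n a -> (i + d <= n)%N -> (a i d <= a 0%N 0%N)%N.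
Proof.
move=> [h1 _ h3 _] id; apply: (@leq_trans (a i 0%N)).
  elim: d id => // d IH; rewrite addnS => lt; have := h1 i d lt; have := IH (ltnW lt); lia.
elim: i {id} (leq_trans (leq_addr d i) id) => // i IH lt.
have := h3 i 0%N; rewrite addn0 => /(_ lt); have := IH (ltnW lt); lia.
Qed.

Lemma side_ladder a : side n a -> (a 0%N 0%N <= r)%N ->
  exists2 X, ladder X & forall i d, (i + d <= n)%N -> a i d = cnt (X i) d.
Proof.
move=> sa a00; have [h1 h2 h3 h4] := sa.
pose P i (m : nat) := [pred d : 'I_n.+1 | (i + d <= n)%N && (m < a i d)%N].
pose X i : vec := [ffun m : 'I_r => inord #|P i m|].
have mono i d e : (d <= e)%N -> (i + e <= n)%N -> (a i e <= a i d)%N.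
  move=> /subnK <-; elim: (e - d)%N => // t IH; rewrite addSn addnS => lt.
  have := h1 i (t + d)%N lt; have := IH (ltnW lt); lia.
have dP i m (j k : 'I_n.+1) : (j <= k)%N -> P i m k -> P i m j.
  move=> jk /andP[ik mk]; apply/andP; split; first by lia.
  by apply: leq_trans mk (mono _ _ _ jk ik).
(* The offset [d = n] is never counted, since [a] vanishes in the last column; hence [inord] does
   not truncate. *)
have leP i m : (#|P i m| < n.+1)%N.
  rewrite ltnS leqNgt (@ltn_card_down _ (P i m) ord_max); last exact: dP.
  apply/negP => /andP[/= iN].
  have -> : i = 0%N by lia.
  by rewrite (side_last sa).
have XE i (m : 'I_r) d : (d <= n)%N -> (d < X i m)%N = (i + d <= n)%N && (m < a i d)%N.
  move=> dn; rewrite ffunE inordK ?leP //.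
  by rewrite (@ltn_card_down _ (P i m) (Ordinal (dn : (d < n.+1)%N))) //; apply: dP.
have Xn i (m : 'I_r) : (X i m <= n)%N by rewrite -ltnS ltn_ord.
exists X; first split.
- move=> i iN; apply/forallP => m; apply/forallP => m'; apply/implyP => mm'.
  case: (posnP (X i m')) => [->|]; first by rewrite orbT.
  case E: (X i m' : nat) => [|d] // _; rewrite orbF.
  have dn : (d < n)%N by rewrite -E Xn.
  have := ltnSn d; rewrite -{2}E XE; last exact: ltnW.
  (* Along a row [a] drops by at most one per step, so [m < m' < a i d] gives [m < a i d.+1], which
     makes the decrease strict. The last column is excluded because [a] vanishes there. *)
  move=> /andP[id ma]; have lt : (i + d < n)%N.
    rewrite ltn_neqAle id andbT; apply/eqP => /(side_last sa) a0; by rewrite a0 in ma.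
  rewrite XE //; have := h1 i d lt; lia.
- move=> i iN; apply/forallP => m; rewrite /stp.
  suff : (X i.+1 m <= X i m <= (X i.+1 m).+1)%N by lia.
  apply/andP; split; rewrite leqNgt; apply/negP => lt.
    have := lt; rewrite XE // => /andP[id ma].
    have := h3 i (X i m); have := XE i m (X i m) (Xn _ _); rewrite ltnn; lia.
  have le := leq_trans lt (Xn i m).
  have := lt; rewrite XE; last exact: ltnW le.
  move=> /andP[id ma]; have := h2 i (X i.+1 m); have := XE i.+1 m (X i.+1 m) (Xn _ _); rewrite ltnn; lia.
- apply/ffunP => m; apply/val_inj; rewrite [in RHS]ffunE /=; apply/eqP.
  by rewrite -leqn0 leqNgt XE // h4 ltn0 andbF.
move=> i d id; rewrite /cnt -[LHS](@card_ltn_ord r); last first.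
  exact: leq_trans (side_leq0 sa id) a00.
apply: eq_card => m; rewrite !inE XE ?id //; lia.
Qed.

End Ladders.

(** * The bijection between square arrays and pairs of walks *)

Lemma valid_tr r n (A : 'M[int]_n) :
  valid_arrays r n n A -> valid_arrays r n n A^T.
Proof.
move=> [[c0 c1] st bd]; split.
- by split=> i j hi hj; rewrite mxE; [apply: c0 | apply: c1].
- move=> i i' j j' p; rewrite !mxE; apply: st.
  by case: p => -[h1 h2]; [apply: Or32 | apply: Or31 | apply: Or33].
- by move=> i j; rewrite mxE maxnC; apply: bd.
Qed.

Lemma valid_side r n (A : 'M[int]_n.+1) : valid_arrays r n.+1 n.+1 A ->
  let a i d := absz (A (inord i) (inord (i + d)) - (i + d)%:Z + r%:Z) in
  [/\ side n a, a 0%N 0%N = r &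
    forall i d, (i + d <= n)%N -> A (inord i) (inord (i + d)) = (i + d)%:Z - r%:Z + (a i d)%:Z].
Proof.
move=> [[c0 c1] st bd] a.
have aE i d : (i + d <= n)%N ->
    A (inord i) (inord (i + d)) = (i + d)%:Z - r%:Z + (a i d)%:Z.
  move=> id; have := bd (inord i) (inord (i + d)).
  by rewrite !inordK ?ltnS ?(leq_trans (leq_addr d i)) // /a; lia.
have stE i j i' j' : (i <= n)%N -> (j <= n)%N -> precedes i' j' i j ->
    A (inord i) (inord j) = A (inord i') (inord j') \/
    A (inord i) (inord j) = A (inord i') (inord j') + 1.
  move=> iN jN p; have [i'n j'n] : (i' <= n)%N /\ (j' <= n)%N.
    by case: p => -[]; lia.
  by apply: st; rewrite !inordK.
split => //; first split.
- move=> i d id; have iN : (i <= n)%N by lia.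
  have le1 : (i + d <= n)%N by lia.
  have le2 : (i + d.+1 <= n)%N by lia.
  have p : precedes i (i + d) i (i + d.+1) by apply: Or32; lia.
  by have := stE _ _ _ _ iN le2 p; rewrite !aE //; lia.
- move=> i d id; have iN : (i.+1 <= n)%N by lia.
  have le1 : (i + d.+1 <= n)%N by lia.
  have le2 : (i.+1 + d <= n)%N by lia.
  have p : precedes i (i + d.+1) i.+1 (i.+1 + d) by apply: Or31; lia.
  by have := stE _ _ _ _ iN le2 p; rewrite !aE //; lia.
- move=> i d id; have iN : (i.+1 <= n)%N by lia.
  have le1 : (i + d <= n)%N by lia.
  have le2 : (i.+1 + d <= n)%N by lia.
  have p : precedes i (i + d) i.+1 (i.+1 + d) by apply: Or33; lia.
  by have := stE _ _ _ _ iN le2 p; rewrite !aE //; lia.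
- have := aE n 0%N; rewrite addn0 => /(_ (leqnn n)).
  by rewrite c1 ?inordK // maxnn; lia.
- have := aE 0%N 0%N; rewrite addn0 => /(_ isT).
  by rewrite c0 ?inordK //; lia.
Qed.

Section Arrays.
Variables (r n : nat).
Notation vec := {ffun 'I_r -> 'I_n.+1}.

Definition glue (a b : nat -> nat -> nat) : 'M[int]_n.+1 :=
  \matrix_(i, j) (if (i <= j)%N then j%:Z - r%:Z + (a i (j - i)%N)%:Z
                  else i%:Z - r%:Z + (b j (i - j)%N)%:Z).

Lemma glue_valid a b : side n a -> side n b ->
  (forall i, (i <= n)%N -> a i 0%N = b i 0%N) -> a 0%N 0%N = r ->
  valid_arrays r n.+1 n.+1 (glue a b).
Proof.
move=> sa sb ab a0.
have gU (i j : 'I_n.+1) : (i <= j)%N ->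
    glue a b i j = j%:Z - r%:Z + (a i (j - i)%N)%:Z.
  by move=> ij; rewrite mxE ij.
have gL (i j : 'I_n.+1) : (j <= i)%N ->
    glue a b i j = i%:Z - r%:Z + (b j (i - j)%N)%:Z.
  rewrite leq_eqVlt => /orP[/eqP ji|ji]; last by rewrite mxE leqNgt ji.
  by rewrite mxE ji leqnn subnn ab // -ltnS.
have [a1 a2 a3 a4] := sa; have [b1 b2 b3 b4] := sb.
split.
- split=> i j [hi] [hj].
    by rewrite gU hi ?hj // a0; lia.
  by rewrite gU hi ?hj // subnn a4; lia.
- move=> i i' j j' p; have iN := ltn_ord i; have jN := ltn_ord j.
  (* Vertical, horizontal and diagonal neighbours use [a2], [a1], [a3] above the diagonal. Below it
     they use [b1], [b2], [b3], as transposition exchanges the first two. *)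
  case: p => -[p1 p2].
  + case: (leqP i j) => ij.
      rewrite !gU; try lia; have := a2 i' (j - i)%N.
      by rewrite p1 p2 (_ : j - i' = (j - i).+1)%N; lia.
    rewrite !gL; try lia; have := b1 j (i' - j)%N.
    by rewrite p2 (_ : i - j = (i' - j).+1)%N; lia.
  + case: (leqP i j') => ij.
      rewrite !gU; try lia; have := a1 i (j' - i)%N.
      by rewrite p1 (_ : j - i = (j' - i).+1)%N; lia.
    rewrite !gL; try lia; have := b2 j' (i - j)%N.
    by rewrite p1 p2 (_ : i - j' = (i - j).+1)%N; lia.
  + case: (leqP i j) => ij.
      rewrite !gU; try lia; have := a3 i' (j - i)%N.
      by rewrite p1 (_ : j' - i' = j - i)%N; lia.
    rewrite !gL; try lia; have := b3 j' (i - j)%N.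
    by rewrite p2 (_ : i' - j' = i - j)%N; lia.
- move=> i j; have iN := ltn_ord i; have jN := ltn_ord j.
  case: (leqP i j) => ij.
    by rewrite gU //; have := side_leq0 (i := i) (d := (j - i)%N) sa; lia.
  by rewrite gL 1?ltnW //; have := side_leq0 (i := j) (d := (i - j)%N) sb; have := ab 0%N; lia.
Qed.

Definition array_of (q : seq (vec * vec)) : 'M[int]_n.+1 :=
  glue (fun i => cnt (nth (zeros r n) q i).1) (fun i => cnt (nth (zeros r n) q i).2).

Lemma full_walks_ladder q : q \in full_walks r n ->
  [/\ size q = n.+1,
    ladder (fun i => (nth (zeros r n) q i).1), ladder (fun i => (nth (zeros r n) q i).2),
    forall i, (i <= n)%N -> cnt (nth (zeros r n) q i).1 0 = cnt (nth (zeros r n) q i).2 0 &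
    cnt (nth (zeros r n) q 0).1 0 = r].
Proof.
move=> /mem_full_walks[sq st qn oks steps]; split => //.
- split; last by rewrite qn.
    by move=> i /oks /and3P[].
  by move=> i /steps /andP[].
- split; last by rewrite qn.
    by move=> i /oks /and3P[].
  by move=> i /steps /andP[].
- move=> i /oks /and3P[_ _ /forallP sup]; apply: eq_card => m.
  by rewrite !inE !lt0n (eqP (sup m)).
- case/andP: st => _ /forallP pos; rewrite -[RHS]card_ord; apply: eq_card => m.
  by rewrite !inE lt0n pos.
Qed.

Lemma array_of_valid q : q \in full_walks r n -> valid_arrays r n.+1 n.+1 (array_of q).
Proof.
move=> /full_walks_ladder[_ lU lV UV U0].
by apply: glue_valid => //; apply: side_cnt.
Qed.

Lemma array_of_inj : {in full_walks r n &, injective array_of}.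
Proof.
move=> p q pw qw pq.
have [sp pU pV pUV _] := full_walks_ladder pw.
have [sq qU qV qUV _] := full_walks_ladder qw.
have E1 : forall i, (i <= n)%N -> (nth (zeros r n) p i).1 = (nth (zeros r n) q i).1.
  apply: (ladder_inj pU qU) => i d id.
  have iN : (i < n.+1)%N by lia.
  have dN : (i + d < n.+1)%N by lia.
  have := congr1 (fun M : 'M[int]_n.+1 => M (Ordinal iN) (Ordinal dN)) pq.
  by rewrite !mxE /= leq_addr addKn; lia.
have E2 : forall i, (i <= n)%N -> (nth (zeros r n) p i).2 = (nth (zeros r n) q i).2.
  (* On the diagonal the array records only the upper family; there the lower count is recovered
     from the common number of live walkers. *)
  apply: (ladder_inj pV qV) => i [|d] id.
    by rewrite -pUV ?E1 ?qUV //; lia.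
  have iN : (i < n.+1)%N by lia.
  have dN : (i + d.+1 < n.+1)%N by lia.
  have := congr1 (fun M : 'M[int]_n.+1 => M (Ordinal dN) (Ordinal iN)) pq.
  rewrite !mxE /= addKn leqNgt addnS ltnS leq_addr /=; lia.
apply: (@eq_from_nth _ (zeros r n)); first by rewrite sp.
move=> i; rewrite sp ltnS => iN.
by rewrite [LHS]surjective_pairing E1 // E2 // -surjective_pairing.
Qed.

(** The upper family is read off [A] and the lower one off its transpose; they share the diagonal,
    hence the live walkers at each time. *)
Lemma array_of_surj A : valid_arrays r n.+1 n.+1 A ->
  exists2 q, q \in full_walks r n & array_of q = A.
Proof.
move=> vA; have := valid_side vA; set a := fun i d => _ => -[sa a0 aE].
have := valid_side (valid_tr vA); set b := fun i d => _ => -[sb b0 bE].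
have ab i : a i 0%N = b i 0%N by rewrite /a /b mxE addn0.
have [U lU aU] := side_ladder sa (eq_leq a0).
have [V lV bV] := side_ladder sb (eq_leq b0).
have [gU sU U0] := lU; have [gV sV V0] := lV.
pose q := mkseq (fun i => (U i, V i)) n.+1.
have qE i : (i <= n)%N -> nth (zeros r n) q i = (U i, V i).
  by move=> iN; rewrite nth_mkseq.
have okq i : (i <= n)%N -> ok (U i, V i).
  move=> iN; apply/and3P; split; [exact: gU | exact: gV |].
  apply/forallP => m; apply/eqP/negb_inj; rewrite -!lt0n /= -!cnt_lt ?gU ?gV //.
  by rewrite -aU -?bV ?addn0 // ab.
exists q.
  apply/mem_full_walks; split.
  - by rewrite size_mkseq.
  - rewrite qE // /start okq //=; apply/forallP => m.
    by rewrite -lt0n -cnt_lt ?gU // -aU // a0.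
  - by rewrite qE // U0 V0.
  - by move=> i iN; rewrite qE ?okq.
  - move=> i iN; rewrite !qE ?(ltnW iN) //; apply/andP; split; [exact: sU | exact: sV].
apply/matrixP => i j; rewrite mxE !qE ?leq_ord //=.
case: (leqP i j) => ij.
  have := aE i (j - i)%N; rewrite subnKC // !inord_val => /(_ (leq_ord j)) ->.
  by rewrite -aU // subnKC ?leq_ord.
have ji := ltnW ij.
have := bE j (i - j)%N; rewrite subnKC // mxE !inord_val => /(_ (leq_ord i)) ->.
by rewrite -bV // subnKC ?leq_ord.
Qed.

Lemma H_full_walks : H r n.+1 n.+1 = size (full_walks r n).
Proof.
rewrite /H -(size_map array_of); apply: perm_size; apply: uniq_perm.
- exact: fset_uniq.
- by rewrite (map_inj_in_uniq array_of_inj) uniq_full_walks.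
move=> A; apply/idP/mapP => [|[q qw ->]].
  rewrite in_fset_set ?inE; last exact: finite_valid_arrays.
  by move=> /array_of_surj[q qw <-]; exists q.
rewrite in_fset_set; last exact: finite_valid_arrays.
by rewrite inE; apply: array_of_valid.
Qed.

Lemma H_sum_det : (H r n.+1 n.+1)%:R =
  \sum_(l <- decs r n.+1) \sum_(l' <- decs r n.+1)
    \det (\matrix_(i < r, j < r) G n (nth 0%N l i) (nth 0%N l' j)).
Proof.
rewrite H_full_walks size_full_walks sum_start.
rewrite -(big_sdec r n (fun l => \sum_(l' <- decs r n.+1)
    \det (\matrix_(i < r, j < r) G n (nth 0%N l i) (nth 0%N l' j)))).
apply: eq_bigr => x _; rewrite -(big_sdec r n (fun l' =>
    \det (\matrix_(i < r, j < r) G n (nth 0%N (vlist x) i) (nth 0%N l' j)))).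
apply: eq_bigr => y _; congr (\det _); apply/matrixP => i j.
by rewrite !mxE !nth_vlist.
Qed.

End Arrays.

Lemma D_finite_H r : D_finite (fun n => (H r n n)%:R).
Proof.
have [d [p [p0 pE]]] := D_finite_sum_det r hol3_G.
(* An array of size [n + 1] corresponds to [n] steps, which is why the kernel is [G] at the
   predecessor of the size. *)
exists d, p; split => // -[|n] // _.
by rewrite -[RHS](pE n.+1 isT); apply: eq_bigr => i _; rewrite addSn H_sum_det.
Qed.

Theorem theorem3 :
  (forall r : nat, (2 <= r)%N -> D_finite (fun n : nat => (H r n n)%:R)) /\
  D_finite (fun n : nat => (H 2 n n)%:R) /\
  D_finite (fun n : nat => (H 3 n n)%:R).
Proof. by split; [move=> r _ | split]; apply: D_finite_H. Qed.
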